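(* Let $U$ be a linear random dynamical system (time set $\mathbb R$) of compact operators on a real separable Hilbert space $H$ over $(\Omega,\mathcal F,\mathbb P,(\theta_t)_{t\in\mathbb R})$. Suppose that the integrability condition $$\mathbb{E}\log^+\sup_{0\le t\le 1}\|U^{\pm}(t,\omega)\|+\mathbb{E}\log^+\sup_{0\le t\le 1}\|U^{\pm}(1-t,\theta_t\omega)\|<\infty$$ is satisfied (for both choices of sign), and suppose that $\alpha,\beta,\gamma\in\mathbb R$ are not contained in the Lyapunov spectrum $\{\lambda_1,\lambda_2,\ldots\}$ of $U$ and are such that the spectrum is arranged as $$\cdots<\lambda_i<-\alpha<-\gamma<\lambda_j<\gamma<\beta<\cdots<\lambda_2<\lambda_1 .$$ Then there exists a $\{\theta_t\}_{t\in\mathbb R}$-invariant set $\tilde\Omega$ of full measure such that for $\omega\in\tilde\Omega$ the following properties hold. There exist linear spaces $E^u(\omega),E^c(\omega),E^s(\omega)$ such that $$H=E^u(\omega)\oplus E^c(\omega)\oplus E^s(\omega),$$ and there exist tempered random variables $K^s(\omega)$, $K^c(\omega)$ and $K^u(\omega)$ such that $$\|U^s(t,\omega)\|\le K^s(\omega)\exp(-\alpha t),\quad t\ge0,$$ $$\|U^c(t,\omega)\|\le K^c(\omega)\exp(\gamma|t|),\quad t\in\mathbb R,$$ $$\|U^u(t,\omega)\|\le K^u(\omega)\exp(\beta t),\quad t\le0,$$ where $U^s(t,\omega),U^c(t,\omega),U^u(t,\omega)$ denote the restrictions of $U(t,\omega)$ to $E^s(\omega),E^c(\omega),E^u(\omega)$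 respectively.
   Context: $(\Omega,\mathcal F,\mathbb P)$ is a complete probability space and $\theta:\mathbb R\times\Omega\to\Omega$, $\theta_t\omega=\theta(t,\omega)$, is a group of $\mathbb P$-preserving ergodic transformations. A random dynamical system $(U,\theta)$ on $H$ with time set $\mathbb T=\mathbb R$ is a jointly measurable mapping $U:\mathbb T\times\Omega\times H\to H$ with $U(t_1+t_2,\omega)=U(t_2,\theta_{t_1}\omega)\circ U(t_1,\omega)$ and $U(0,\omega)x=x$; it is linear if each $U(t,\omega)$ is linear. Notation: $U^+(t,\omega)=U(t,\omega)$ and $U^-(t,\omega)=U(t,\theta_t^{-1}\omega)^{-1}=U(-t,\omega)$ for $t\ge0$; $\log^+=\max(\log,0)$; $\|\cdot\|$ is the operator norm. Lyapunov spectrum: by the multiplicative ergodic theorem for such $U$, for $\omega$ in an invariant set of full measure there are linear spaces with $H=W_1(\omega)\oplus W_2(\omega)\oplus\cdots\oplus W_\infty(\omega)$, $U(t,\omega)W_i(\omega)\subset W_i(\theta_t\omega)$ for $t\in\mathbb R$, and distinct non-random numbers $\lambda_1>\lambda_2>\cdots$ with $\lim_{t\to\pm\infty}\frac1t\log\|U(t,\omega)x\|=\lambda_i$ for nonzero $x\in W_i(\omega)$ and $=-\infty$ for nonzero $x\in W_\infty(\omega)$. The $\lambda_i$ are the Lyapunov exponents and their set is the Lyapunov spectrum. A random variable $X:\Omega\to(0,\infty)$ is tempered from above if $\limsup_{t\to\pm\infty}\frac{\log^+X(\theta_t\omega)}{|t|}=0$ for $\omega$ in a $\{\theta_t\}$-invariant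 set of full measure; it is tempered from below if $X^{-1}$ is tempered from above; it is tempered if it is both. *)

(* Defs.v *)
From HB Require Import structures.
From mathcomp Require Import all_boot all_order all_algebra.
From mathcomp Require Import sesquilinear.
From mathcomp Require Import all_classical all_reals all_analysis.
Import Order.TTheory GRing.Theory Num.Theory numFieldNormedType.Exports.

Set Implicit Arguments.
Unset Strict Implicit.
Unset Printing Implicit Defensive.

Local Open Scope classical_set_scope.
Local Open Scope ring_scope.

(* A real inner product inducing the norm; together with the completeness of H
   this makes H a real Hilbert space. *)
Definition induces_norm (R : realType) (H : normedModType R)
  (dot : {dot H for idfun}) : Prop :=
  forall x : H, `|x| ^+ 2 = dot x x.

Definition separable_space (H : topologicalType) : Prop :=
  exists2 D : set H, countable D & dense D.

Definition borel (H : ptopologicalType) := g_sigma_algebraType (@open H).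

Definition compact_operator (R : realType) (H : normedModType R)
  (f : H -> H) : Prop :=
  linear f /\ precompact (f @` [set x | `|x| <= 1]).

(* Operator norm of the restriction of f to the subspace E; it is +oo when that
   restriction is unbounded. *)
Definition opnorm_on (R : realType) (H : normedModType R)
  (E : set H) (f : H -> H) : \bar R :=
  ereal_sup [set (`|f x|)%:E | x in [set x | E x /\ `|x| <= 1]].

Definition opnorm (R : realType) (H : normedModType R) (f : H -> H) : \bar R :=
  opnorm_on setT f.

(* log^+ on [0, +oo]; since lne 0 = -oo, log^+ 0 = 0. *)
Definition logp (R : realType) (x : \bar R) : \bar R := maxe (lne x) 0%E.

Record ergodic_flow (d : measure_display) (T : measurableType d) (R : realType)
  (P : probability T R) (theta : R -> T -> T) : Prop := ErgodicFlow {
  flow0 : forall w, theta 0 w = w;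
  flowD : forall s t w, theta (s + t) w = theta s (theta t w);
  flow_measurable : forall t, measurable_fun setT (theta t);
  flow_preserving : forall t A, measurable A -> P (theta t @^-1` A) = P A;
  flow_ergodic : forall A, measurable A ->
    (forall t, theta t @^-1` A = A) -> P A = 0%E \/ P A = 1%E
}.

Definition invariant_full (d : measure_display) (T : measurableType d)
  (R : realType) (P : probability T R) (theta : R -> T -> T) (A : set T)
  : Prop :=
  [/\ measurable A, P A = 1%E & forall t, theta t @^-1` A = A].

Record linear_rds (d : measure_display) (T : measurableType d) (R : realType)
  (theta : R -> T -> T) (H : completeNormedModType R)
  (U : R -> T -> H -> H) : Prop := LinearRDS {
  rds_measurable : @measurable_fun _ _
    (measurableTypeR R * T * borel H)%type (borel H) setT
    (fun p => U p.1.1 p.1.2 p.2);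
  rds0 : forall w x, U 0 w x = x;
  rdsD : forall t1 t2 w x, U (t1 + t2) w x = U t2 (theta t1 w) (U t1 w x);
  rds_linear : forall t w, linear (U t w)
}.

(* U^+ and U^-: by the cocycle property, U(t, theta_{-t} w)^{-1} = U(-t, w). *)
Definition rds_plus (R : realType) (T H : Type) (U : R -> T -> H -> H)
  (t : R) (w : T) : H -> H := U t w.

Definition rds_minus (R : realType) (T H : Type) (U : R -> T -> H -> H)
  (t : R) (w : T) : H -> H := U (- t) w.

(* Finiteness of the expectations of the nonnegative random variables
   log^+ sup_{0<=t<=1} ||V(t, w)|| and
   log^+ sup_{0<=t<=1} ||V(1-t, theta_t w)||. *)
Definition log_integrable (d : measure_display) (T : measurableType d)
  (R : realType) (P : probability T R) (theta : R -> T -> T)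
  (H : normedModType R) (V : R -> T -> H -> H) : Prop :=
  P.-integrable setT
    (fun w => logp (ereal_sup [set opnorm (V t w) | t in `[0, 1]])) /\
  P.-integrable setT
    (fun w => logp (ereal_sup
      [set opnorm (V (1 - t) (theta t w)) | t in `[0, 1]])).

Definition linear_subspace (R : realType) (H : normedModType R) (E : set H)
  : Prop :=
  E 0 /\ forall a x y, E x -> E y -> E (a *: x + y).

Definition direct_sum3 (R : realType) (H : normedModType R)
  (E F G : set H) : Prop :=
  [/\ linear_subspace E, linear_subspace F, linear_subspace G &
   forall x, exists! y : H * H * H,
     [/\ E y.1.1, F y.1.2, G y.2 & x = y.1.1 + y.1.2 + y.2]].

(* H is the direct sum of the W i, i in I, and of Winf. When I is infinite the
   expansions are norm-convergent series; in a finite-dimensional H this is the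
   algebraic direct sum. *)
Definition direct_sum_seq (R : realType) (H : normedModType R)
  (I : set nat) (W : nat -> set H) (Winf : set H) : Prop :=
  [/\ forall i, I i -> linear_subspace (W i), linear_subspace Winf &
   forall x, exists! y : (nat -> H) * H,
     [/\ forall i, I i -> W i (y.1 i),
         forall i, ~ I i -> y.1 i = 0,
         Winf y.2 &
         series y.1 @ \oo --> x - y.2]].

(* lam enumerates on I, in decreasing order, the Lyapunov exponents of U. The
   exponents are numbered from 0, and I is an initial segment of nat: {0..n-1}
   if there are n exponents, nat if there are infinitely many. U t w x is
   nonzero when x is, so that the convention ln 0 = 0 plays no role. *)
Definition lyapunov_exponents (d : measure_display) (T : measurableType d)
  (R : realType) (P : probability T R) (theta : R -> T -> T)
  (H : completeNormedModType R) (U : R -> T -> H -> H)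
  (I : set nat) (lam : nat -> R) : Prop :=
  [/\ forall i j, I j -> (i <= j)%N -> I i,
      forall i j, I j -> (i < j)%N -> lam j < lam i &
  exists (Omega0 : set T) (W : nat -> T -> set H) (Winf : T -> set H),
    invariant_full P theta Omega0 /\
    forall w, Omega0 w ->
    [/\ direct_sum_seq I (W ^~ w) (Winf w),
        forall i, I i -> exists2 x, W i w x & x != 0,
        (forall i t, I i -> U t w @` W i w `<=` W i (theta t w)) /\
        (forall t, U t w @` Winf w `<=` Winf (theta t w)),
        forall i x, I i -> W i w x -> x != 0 ->
          (ln `|U t w x| / t @[t --> +oo] --> lam i) /\
          (ln `|U t w x| / t @[t --> -oo] --> lam i) &
        forall x, Winf w x -> x != 0 ->
          (ln `|U t w x| / t @[t --> +oo] --> -oo) /\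
          (ln `|U t w x| / t @[t --> -oo] --> -oo)]].

Definition tempered_above (d : measure_display) (T : measurableType d)
  (R : realType) (P : probability T R) (theta : R -> T -> T) (X : T -> R)
  : Prop :=
  exists2 A, invariant_full P theta A &
    forall w, A w ->
      let f t := (Num.max (ln (X (theta t w))) 0 / `|t|)%:E in
      limf_esup f +oo = 0%E /\ limf_esup f -oo = 0%E.

Definition tempered (d : measure_display) (T : measurableType d)
  (R : realType) (P : probability T R) (theta : R -> T -> T) (X : T -> R)
  : Prop :=
  [/\ measurable_fun setT X, forall w, 0 < X w,
      tempered_above P theta X & tempered_above P theta (fun w => (X w)^-1)].

(* Main.v *)
Require Import Defs.
From HB Require Import structures.
From mathcomp Require Import all_boot all_order all_algebra.
From mathcomp Require Import sesquilinear perm finmap.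
From mathcomp Require Import all_classical all_reals all_analysis measurable_realfun.
From mathcomp Require Import ring lra.
Import Order.TTheory GRing.Theory Num.Theory numFieldNormedType.Exports.

Set Implicit Arguments.
Unset Strict Implicit.
Unset Printing Implicit Defensive.
Local Open Scope classical_set_scope.
Local Open Scope ring_scope.

(* The operator U(0,w) is the identity, so its compactness makes the unit ball
   precompact and H finite-dimensional.  Integrability and Borel-Cantelli give
   ||U(t,theta_s w)|| <= exp(o(s)) for |t| <= 1, and the maximal ergodic theorem
   applied to log|det U(1,w)| gives log|det U(t,w)| = delta t + o(t) as
   t -> +oo and t -> -oo with the same delta.  Choose a basis b_1,...,b_n of H
   among the vectors of the W_i(w), with exponents mu_j.  Comparing the
   determinant with the product of the lengths |U(t,w) b_j| at +oo and at -oo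
   forces delta = sum mu_j, and Cramer's rule then bounds the angles between the
   U(t,w) b_j below by exp(o(t)).  Hence |U(t,w) sum c_j b_j| agrees with
   max_j |c_j| exp(mu_j t) up to exp(o(t)), for all real t.

   Each of E^u, E^c, E^s is the set of x whose orbit, sampled at integer times in
   the relevant direction, is bounded by the prescribed exponential; it is the
   span of the corresponding b_j, and the optimal constant grows
   subexponentially along the orbit.  That constant is measurable: by
   compactness of the unit ball, it exceeds c iff for each p a point of a fixed
   countable dense set satisfies the first p constraints up to 2^-p. *)

(** * Finite dimension from compactness of the unit ball *)

(** The splitting [W i] comes with exponents only: nothing is assumed about the angles between the
    blocks or about measurability in [w]. Frames are therefore chosen separately at each [w] and
    never measured; a whole orbit is controlled from the one frame at its starting point. The spaces
    and the constants, in contrast, are defined from [U] alone, at countably many times, so that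
    they make sense at every [w] and the constants can be random variables. Sampling at integer
    times would lose the growth inside unit intervals; the weight [ell] in [weighted_norm] charges
    it to the constant beforehand. Only the flow is assumed ergodic, not each single [theta s]. The
    mean growth of the determinant is therefore not read off from the time-one map alone: the
    exceptional sets are shown to be invariant under every [theta r], which costs a sublinear
    error. *)

Section DotProduct.
Variables (R : realType) (H : normedModType R) (dot : {dot H for idfun}).
Implicit Types x y z : H.

Lemma dotC x y : dot x y = dot y x.
Proof. by rewrite [LHS]hermitian_subproof expr0 mul1r. Qed.

Lemma dotBl x y z : dot (x - y) z = dot x z - dot y z.
Proof. exact: linearBl. Qed.

Lemma dotZl a x y : dot (a *: x) y = a * dot x y.
Proof. exact: linearZl_LR. Qed.

Lemma dotDl x y z : dot (x + y) z = dot x z + dot y z.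
Proof. exact: linearDl. Qed.

Lemma dot_suml I (r : seq I) (F : I -> H) y :
  dot (\sum_(i <- r) F i) y = \sum_(i <- r) dot (F i) y.
Proof. exact: linear_sumlz. Qed.

End DotProduct.

Definition orthonormal (R : realType) (H : normedModType R)
  (dot : {dot H for idfun}) n (e : 'I_n -> H) :=
  forall i j, dot (e i) (e j) = (i == j)%:R.

(** Orthonormal vectors lie at mutual distance sqrt 2, so a ball of radius 1/2 contains at most one
    of them, and the size of a finite cover by such balls is a bound. *)
Lemma orthonormal_size_bound (R : realType) (H : normedModType R)
    (dot : {dot H for idfun}) : induces_norm dot ->
    precompact [set x : H | `|x| <= 1] ->
  exists N, forall n (e : 'I_n -> H), orthonormal dot e -> (n <= N)%N.
Proof.
move=> dotE; rewrite precompactE compact_cover => cB.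
have [|x clx|D _ cov] := cB H setT (fun x => ball x (2^-1 : R)).
- by move=> x _; exact: ball_open.
- by exists x => //; apply: ballxx; rewrite invr_gt0.
exists (size (enum_fset D)); move=> n e one.
have norme i : `|e i| = 1.
  by apply/eqP; rewrite -(@eqrXn2 _ 2)// expr1n dotE one eqxx.
have eD i : exists c, c \in D /\ ball c (2^-1 : R) (e i).
  have := @subset_closure _ [set x : H | `|x| <= 1] (e i).
  by rewrite /= norme => /(_ (lexx _))/cov[c cD Hc]; exists c.
have [f fP] := choice eD.
have injf : injective f.
  move=> i j fij; apply/eqP; apply: contraT => nij.
  have [_ bi] := fP i; have [_ bj] := fP j; rewrite -fij in bj.
  have dij : `|e i - e j| < 1.
    have -> : e i - e j = (f i - e j) - (f i - e i) by rewrite opprB [RHS]addrC addrA subrK.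
    apply: (le_lt_trans (ler_normB _ _)).
    by rewrite [ltRHS](splitr 1) div1r; apply: ltrD; rewrite -ball_normE in bi bj.
  have : `|e i - e j| ^+ 2 = 2.
    rewrite dotE dotBl ![dot _ (_ - _)]dotC !dotBl !one !eqxx (negbTE nij) eq_sym (negbTE nij).
    by rewrite subr0 sub0r opprK.
  by move: dij (normr_ge0 (e i - e j)); nra.
rewrite -[n in leqLHS]size_enum_ord -(size_map f).
apply: uniq_leq_size; first by rewrite map_inj_uniq ?enum_uniq.
by move=> _ /mapP[i _ ->]; case: (fP i).
Qed.

(** In an orthonormal family of maximal size the residual of [x] after projection must vanish:
    otherwise its normalization would extend the family. *)
Lemma orthonormal_basis (R : realType) (H : normedModType R)
    (dot : {dot H for idfun}) : induces_norm dot ->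
    precompact [set x : H | `|x| <= 1] ->
  exists n (e : 'I_n -> H), orthonormal dot e /\
    forall x, x = \sum_i dot x (e i) *: e i.
Proof.
move=> dotE pB; have [N NP] := orthonormal_size_bound dotE pB.
have ex0 : exists n, `[< exists e : 'I_n -> H, orthonormal dot e >].
  by exists 0%N; apply/asboolP; exists (fun=> 0) => -[].
have ub n : `[< exists e : 'I_n -> H, orthonormal dot e >] -> (n <= N)%N.
  by move=> /asboolP[e]; exact: NP.
case: (ex_maxnP ex0 ub) => n /asboolP[e one] nmax.
exists n, e; split=> // x; apply/eqP; rewrite -subr_eq0; apply: contraT => y0.
set y := x - _ in y0.
have dyi i : dot y (e i) = 0.
  rewrite dotBl dot_suml (bigD1 i)//= big1 ?addr0 => [|j ji].
    by rewrite dotZl one eqxx mulr1 subrr.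
  by rewrite dotZl one (negbTE ji) mulr0.
pose e' (i : 'I_n.+1) := if unlift ord0 i is Some j then e j else `|y|^-1 *: y.
suff /nmax : `[< exists e : 'I_n.+1 -> H, orthonormal dot e >] by rewrite ltnn.
apply/asboolP; exists e' => i j; rewrite /e'.
case: (unliftP ord0 i) => [i'|] ->; case: (unliftP ord0 j) => [j'|] ->.
- by rewrite one (inj_eq lift_inj).
- by rewrite dotC dotZl dyi mulr0 eq_sym (negbTE (neq_lift _ _)).
- by rewrite dotZl dyi mulr0 (negbTE (neq_lift _ _)).
- rewrite dotZl dotC dotZl -dotE eqxx expr2 mulrA mulrA.
  by rewrite divfK ?normr_eq0// mulVf// normr_eq0.
Qed.

(** * Coordinates and determinant bounds *)

Section DeterminantBounds.
Variables (R : realType) (n : nat).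
Implicit Types (A : 'M[R]_n) (r : 'I_n -> R).

(** A crude form of Hadamard's inequality, by the Leibniz formula; after taking logarithms the
    factor n! is a mere additive constant. *)
Lemma normr_det_le A r : (forall i j, `|A i j| <= r i) ->
  `|\det A| <= (n`!)%:R * \prod_i r i.
Proof.
move=> Ar; apply: le_trans (ler_norm_sum _ _ _) _.
have -> : (n`!)%:R * \prod_i r i = \sum_(s : 'S_n) \prod_i r i.
  by rewrite sumr_const card_Sn mulr_natl.
apply: ler_sum => s _; rewrite normrM normrX normrN1 expr1n mul1r normr_prod.
by apply: ler_prod => i _; rewrite normr_ge0 Ar.
Qed.

(** Replacing row [k] of [A] by [c *m A] multiplies the determinant by [c 0 k]; the bound on
    determinants is then applied to the new matrix. *)
Lemma cramer_bound A r (c : 'rV[R]_n) k s :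
    (forall i j, `|A i j| <= r i) -> (forall j, `|(c *m A) 0 j| <= s) ->
  `|c 0 k| * `|\det A| <= (n`!)%:R * (s * \prod_(i | i != k) r i).
Proof.
move=> Ar cs; set v := c *m A in cs.
pose B := \matrix_(i, j) (if i == k then v 0 j else A i j).
have detB : c 0 k * \det A = \det B.
  rewrite [RHS](expand_det_row _ k).
  have -> : c 0 k * \det A = (v *m \adj A) 0 k.
    by rewrite /v -mulmxA mul_mx_adj mul_mx_scalar mxE mulrC.
  rewrite mxE; apply: eq_bigr => j _; rewrite [\adj A _ _]mxE [B _ _]mxE eqxx.
  congr (_ * (_ * \det _)); apply/matrixP => a b; rewrite !mxE.
  by rewrite eq_sym (negbTE (neq_lift _ _)).
rewrite -normrM detB.
have Bprod : \prod_i (if i == k then s else r i) = s * \prod_(i | i != k) r i.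
  rewrite (bigD1 k)//= eqxx; congr (_ * _).
  by apply: eq_bigr => i /negbTE->.
rewrite -Bprod; apply: normr_det_le => i j.
by rewrite mxE; case: ifP.
Qed.

End DeterminantBounds.

(** All that is kept of the inner product: linear coordinates dominated by the norm, and unit basis
    vectors. *)
Record chart (R : realType) (H : normedModType R) (n : nat) := Chart {
  cbasis : 'I_n -> H;
  coord :> H -> 'rV[R]_n;
  coord_linear : linear coord;
  coordK : forall x, x = \sum_i coord x 0 i *: cbasis i;
  coord_basis : forall i, coord (cbasis i) = delta_mx 0 i;
  coord_le : forall x i, `|coord x 0 i| <= `|x|;
  cbasis_norm : forall i, `|cbasis i| = 1 }.

Lemma chart_of_precompact_ball (R : realType) (H : normedModType R)
    (dot : {dot H for idfun}) : induces_norm dot ->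
  precompact [set x : H | `|x| <= 1] -> exists n, inhabited (chart H n).
Proof.
move=> dotE /(orthonormal_basis dotE)[n [e [one ex]]]; exists n.
have norme i : `|e i| = 1.
  by apply/eqP; rewrite -(@eqrXn2 _ 2)// expr1n dotE one eqxx.
have dot_expand (x : H) : `|x| ^+ 2 = \sum_i dot x (e i) ^+ 2.
  rewrite dotE {1}[x in dot x]ex dot_suml; apply: eq_bigr => i _.
  by rewrite dotZl dotC expr2.
constructor; exists e (fun x => \row_i dot x (e i)).
- by move=> a x y; apply/rowP => i; rewrite !mxE dotDl dotZl.
- by move=> x; rewrite [LHS]ex; apply: eq_bigr => i _; rewrite mxE.
- by move=> i; apply/rowP => j; rewrite !mxE one eq_sym.
- move=> x i; rewrite mxE -(@ler_pXn2r _ 2) ?nnegrE ?normr_ge0// dot_expand -normrX.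
  rewrite ger0_norm ?sqr_ge0//.
  by rewrite (bigD1 i)//= lerDl sumr_ge0// => j _; rewrite sqr_ge0.
- exact: norme.
Qed.

Section ChartTheory.
Variables (R : realType) (H : normedModType R) (n : nat) (ch : chart H n).
Implicit Types (x y : H) (f g : H -> H).

Lemma coordD x y : ch (x + y) = ch x + ch y.
Proof. by rewrite -[x in LHS]scale1r coord_linear scale1r. Qed.

Lemma coord0 : ch 0 = 0.
Proof. by apply: (addrI (ch 0)); rewrite -coordD !addr0. Qed.

Lemma coordZ a x : ch (a *: x) = a *: ch x.
Proof. by rewrite -[_ *: _]addr0 coord_linear coord0 addr0. Qed.

Lemma coord_sum I (r : seq I) (P : pred I) (F : I -> H) :
  ch (\sum_(i <- r | P i) F i) = \sum_(i <- r | P i) ch (F i).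
Proof. by apply: (big_morph _ coordD coord0). Qed.

Lemma coord_inj : injective ch.
Proof. by move=> x y xy; rewrite (coordK ch x) (coordK ch y) xy. Qed.

(** Coordinates are row vectors, so the matrix acts on the right and a composition multiplies in the
    order of application. *)
Definition chart_mx f : 'M[R]_n := \matrix_i ch (f (cbasis ch i)).

Lemma linear_sumZ f I (r : seq I) (a : I -> R) (F : I -> H) : linear f ->
  f (\sum_(i <- r) a i *: F i) = \sum_(i <- r) a i *: f (F i).
Proof.
move=> lf; pose F' : {linear H -> H} :=
  HB.pack f (GRing.isLinear.Build _ _ _ _ f lf).
rewrite [LHS](linear_sum F'); apply: eq_bigr => i _.
exact: (linearZ_LR F').
Qed.

Lemma coord_mul f x : linear f -> ch (f x) = ch x *m chart_mx f.
Proof.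
move=> lf; rewrite [x in LHS](coordK ch) linear_sumZ// coord_sum.
apply/rowP => j; rewrite summxE mxE; apply: eq_bigr => i _.
by rewrite coordZ !mxE.
Qed.

Lemma chart_mx_comp f g : linear g ->
  chart_mx (g \o f) = chart_mx f *m chart_mx g.
Proof.
move=> lg; apply/row_matrixP => i; rewrite row_mul !rowK /=.
by rewrite coord_mul.
Qed.

Lemma chart_mx_id : chart_mx id = 1%:M.
Proof. by apply/row_matrixP => i; rewrite rowK coord_basis row1. Qed.

End ChartTheory.

(** * Subexponential errors and regular bases *)

(** An upper bound o(|t|) at both ends of the line at once, with one constant valid for all real
    [t]. Two-sided estimates are obtained by applying it to absolute values. *)
Definition sublinear (R : realType) (f : R -> R) :=
  forall e, 0 < e -> exists C, forall t, f t <= C + e * `|t|.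

Section Sublinear.
Variable R : realType.
Implicit Types f g : R -> R.

Lemma sublinear_le f g : (forall t, f t <= g t) -> sublinear g -> sublinear f.
Proof.
by move=> fg sg e e0; have [C CP] := sg e e0; exists C => t; exact: le_trans (CP t).
Qed.

Lemma sublinear_cst c : sublinear (fun=> c : R).
Proof. by move=> e e0; exists c => t; rewrite lerDl mulr_ge0// ltW. Qed.

Lemma sublinearD f g : sublinear f -> sublinear g -> sublinear (fun t => f t + g t).
Proof.
move=> sf sg e e0; have e20 : 0 < e / 2 by rewrite divr_gt0.
have [C CP] := sf _ e20; have [D DP] := sg _ e20; exists (C + D) => t.
by have := CP t; have := DP t; have := normr_ge0 t; lra.
Qed.

Lemma sublinear_sum I (r : seq I) (P : pred I) (F : I -> R -> R) :
  (forall i, sublinear (F i)) -> sublinear (fun t => \sum_(i <- r | P i) F i t).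
Proof.
move=> sF; elim: r => [|i r IH].
  by apply: sublinear_le (sublinear_cst 0) => t; rewrite big_nil.
case: (boolP (P i)) => Pi.
  by apply: sublinear_le (sublinearD (sF i) IH) => t; rewrite big_cons Pi.
by apply: sublinear_le IH => t; rewrite big_cons (negbTE Pi).
Qed.

Lemma linear_le_sublinear_eq0 a f :
  sublinear f -> (forall t, a * t <= f t) -> a = 0.
Proof.
move=> sf af; apply/eqP; apply: contraT => a0.
have na0 : 0 < `|a| by rewrite normr_gt0.
have [C CP] := sf (`|a| / 2) ltac:(by rewrite divr_gt0).
(* The test point has the sign of [a], and its size is such that |a| s / 2 = |C| + 1 exceeds [C]. *)
pose s := 2 * (`|C| + 1) / `|a|.
have s0 : 0 < s by rewrite divr_gt0// mulr_gt0// ltr_pwDr.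
have sa : `|a| * s = 2 * (`|C| + 1) by rewrite mulrC divfK ?gt_eqF.
have := le_trans (af (Num.sg a * s)) (CP (Num.sg a * s)).
rewrite mulrA [a * _]mulrC -normrEsg sa normrM normr_sg a0 mul1r (gtr0_norm s0).
by have := ler_norm C; have := normr_ge0 C; nra.
Qed.

End Sublinear.

Section RegularBasis.
Variables (R : realType) (H : normedModType R) (n : nat) (ch : chart H n).
Variables (V : R -> H -> H) (b : 'I_n -> H) (mu : 'I_n -> R) (delta : R).
Hypotheses (V_linear : forall t, linear (V t)) (V_neq0 : forall t j, V t (b j) != 0).
Let B : 'M[R]_n := \matrix_i ch (b i).
Hypotheses (detB : \det B != 0) (detV : forall t, \det (chart_mx ch (V t)) != 0).
Hypothesis lyap :
  forall j, sublinear (fun t => `|ln `|V t (b j)| - mu j * t|).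
Hypothesis lyap_det :
  sublinear (fun t => `|ln `|\det (chart_mx ch (V t))| - delta * t|).

Let F t : 'M[R]_n := \matrix_i ch (V t (b i)).

Let F_mul t : F t = B *m chart_mx ch (V t).
Proof. by apply/row_matrixP => i; rewrite row_mul !rowK coord_mul. Qed.

Let F_le t i j : `|F t i j| <= `|V t (b i)|.
Proof. by rewrite mxE coord_le. Qed.

Let Vb_gt0 t j : 0 < `|V t (b j)|.
Proof. by rewrite normr_gt0. Qed.

Let F_gt0 t : 0 < `|\det (F t)|.
Proof. by rewrite F_mul det_mulmx normr_gt0 mulf_neq0. Qed.

Let fact_gt0' : (0 : R) < n`!%:R.
Proof. by rewrite ltr0n fact_gt0. Qed.

Let ln_prod (P : pred 'I_n) t :
  ln (\prod_(i | P i) `|V t (b i)|) = \sum_(i | P i) ln `|V t (b i)|.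
Proof.
suff [] : 0 < \prod_(i | P i) `|V t (b i)| /\
  ln (\prod_(i | P i) `|V t (b i)|) = \sum_(i | P i) ln `|V t (b i)| by [].
apply: (big_ind2 (fun p q => 0 < p /\ ln p = q)) => [|x y x' y' [x0 <-] [y0 <-]|i _].
- by rewrite ln1.
- by rewrite mulr_gt0// lnM.
- by [].
Qed.

Let ln_detF t : ln `|\det (F t)| = ln `|\det B| + ln `|\det (chart_mx ch (V t))|.
Proof. by rewrite F_mul det_mulmx normrM lnM// posrE normr_gt0. Qed.

Lemma ln_det_frame_le t : ln `|\det B| + ln `|\det (chart_mx ch (V t))| <=
  ln n`!%:R + \sum_i ln `|V t (b i)|.
Proof.
rewrite -ln_detF -ln_prod -lnM ?posrE ?prodr_gt0//.
by rewrite ler_ln ?posrE ?mulr_gt0 ?prodr_gt0//; exact: normr_det_le.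
Qed.

(** One error for the lower and the upper bound: the constants of Cramer's rule plus every deviation
    from linear growth. All its terms are nonnegative, so any of them may be dropped. *)
Definition regularity_error t : R :=
  `|ln `|\det B| | + ln n`!%:R + `|ln `|\det (chart_mx ch (V t))| - delta * t| +
  \sum_i `|ln `|V t (b i)| - mu i * t|.

Lemma regularity_error_sublinear : sublinear regularity_error.
Proof.
apply: sublinearD; last exact: sublinear_sum.
by apply: sublinearD => //; exact: sublinear_cst.
Qed.

(** The determinant inequality is one-sided, but it holds for [t] of both signs, and a linear
    function below a sublinear one on the whole line is zero. *)
Lemma sum_lyapunov : delta = \sum_i mu i.
Proof.
apply/eqP; rewrite -subr_eq0; apply/eqP.
apply: (linear_le_sublinear_eq0 regularity_error_sublinear) => t.
have detF := ln_det_frame_le t; rewrite /regularity_error.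
have sumE : \sum_i ln `|V t (b i)| - (\sum_i mu i) * t <=
    \sum_i `|ln `|V t (b i)| - mu i * t|.
  by rewrite mulr_suml -sumrB ler_sum// => i _; exact: ler_norm.
have := ler_norm (- ln `|\det B|); rewrite normrN.
have := ler_norm (- (ln `|\det (chart_mx ch (V t))| - delta * t)); rewrite normrN.
by lra.
Qed.

(* Cramer's rule in the basis [V t (b j)]: its determinant has the same growth
   as the product of the lengths of its vectors, so the angles between them
   decay subexponentially. *)
Lemma regular_lower t (c : 'I_n -> R) k :
  `|c k| * expR (mu k * t - regularity_error t) <= `|V t (\sum_j c j *: b j)|.
Proof.
have [->|ck0] := eqVneq (c k) 0; first by rewrite normr0 mul0r.
set x := \sum_j _.
have cF : ch (V t x) = (\row_j c j) *m F t.
  rewrite linear_sumZ// coord_sum; apply/rowP => j; rewrite summxE mxE.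
  by apply: eq_bigr => i _; rewrite coordZ !mxE.
have : `|(\row_j c j) 0 k| * `|\det (F t)| <=
    n`!%:R * (`|V t x| * \prod_(i | i != k) `|V t (b i)|).
  by apply: cramer_bound => [i j|j]; rewrite ?F_le// -cF coord_le.
rewrite mxE => le0.
have lhs0 : 0 < `|c k| * `|\det (F t)| by rewrite mulr_gt0// normr_gt0.
have prod0 : 0 < \prod_(i | i != k) `|V t (b i)| by rewrite prodr_gt0.
have Vx0 : 0 < `|V t x|.
  by have := lt_le_trans lhs0 le0; rewrite pmulr_rgt0// pmulr_lgt0.
have : ln (`|c k| * `|\det (F t)|) <=
    ln (n`!%:R * (`|V t x| * \prod_(i | i != k) `|V t (b i)|)).
  by rewrite ler_ln ?posrE// (lt_le_trans lhs0).
rewrite !lnM ?posrE ?mulr_gt0// ?normr_gt0// ln_prod ln_detF => le1.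
rewrite -[X in X * _]lnK ?posrE ?normr_gt0// -expRD -[leRHS]lnK ?posrE// ler_expR.
(* Removing the other n - 1 exponents from the rate [delta] of the determinant leaves exactly
   [mu k]. *)
have := sum_lyapunov; rewrite (bigD1 k)//= => dE.
have sumE : \sum_(i | i != k) ln `|V t (b i)| - (\sum_(i | i != k) mu i) * t <=
    \sum_i `|ln `|V t (b i)| - mu i * t|.
  rewrite mulr_suml -sumrB [leRHS](bigD1 k)//= ler_wpDl// ler_sum// => i _.
  exact: ler_norm.
have := ler_norm (- ln `|\det B|); rewrite normrN.
have := ler_norm (- (ln `|\det (chart_mx ch (V t))| - delta * t)); rewrite normrN.
by rewrite /regularity_error dE; lra.
Qed.

Lemma regular_upper t (c : 'I_n -> R) :
  `|V t (\sum_j c j *: b j)| <=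
  \sum_j `|c j| * expR (mu j * t + regularity_error t).
Proof.
rewrite linear_sumZ//; apply: le_trans (ler_norm_sum _ _ _) _.
apply: ler_sum => j _; rewrite normrZ ler_wpM2l// -[leLHS]lnK ?posrE// ler_expR.
have := ler_norm (ln `|V t (b j)| - mu j * t).
have : `|ln `|V t (b j)| - mu j * t| <= regularity_error t.
  rewrite /regularity_error (bigD1 j)//= addrCA lerDl.
  by rewrite !addr_ge0// ?sumr_ge0// ln_ge0// ler1n fact_gt0.
by lra.
Qed.

End RegularBasis.

(** * A basis inside a set with dense span *)

Section BasisFromDenseSpan.
Variables (R : realType) (H : normedModType R) (n : nat) (ch : chart H n).

Definition coord_mx k (b : 'I_k -> H) : 'M[R]_(k, n) := \matrix_i ch (b i).

Lemma coord_functional_le p (K : 'M[R]_(n, p)) j :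
  exists C, forall x, `|(ch x *m K) 0 j| <= C * `|x|.
Proof.
exists (\sum_i `|K i j|) => x; rewrite mxE mulr_suml.
apply: le_trans (ler_norm_sum _ _ _) _; apply: ler_sum => i _.
by rewrite normrM mulrC ler_wpM2l// coord_le.
Qed.

(** Take a linearly independent family in [S] of maximal size. Sums from [S] need only be dense
    because the Oseledets expansion is a convergent series; no topology on subspaces is needed,
    since bounded functionals that vanish on [S] vanish everywhere. *)
Lemma basis_of_dense_span (S : set H) :
    (forall x e, 0 < e -> exists r : seq H,
      (forall y, y \in r -> S y) /\ `|x - \sum_(y <- r) y| < e) ->
  exists b : 'I_n -> H, (forall i, S (b i)) /\ \det (coord_mx b) != 0.
Proof.
move=> dense.
pose free_in k := exists b : 'I_k -> H,
  (forall i, S (b i)) /\ row_free (coord_mx b).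
have ex0 : exists k, `[< free_in k >].
  exists 0%N; apply/asboolP; exists (fun=> 0); split; first by case.
  by rewrite /row_free -leqn0 rank_leq_row.
have ub k : `[< free_in k >] -> (k <= n)%N.
  by move=> /asboolP[b [_ /eqP <-]]; exact: rank_leq_col.
case: (ex_maxnP ex0 ub) => k /asboolP[b [bS bfree]] kmax.
have Ssub v : S v -> (ch v <= coord_mx b)%MS.
  move=> Sv; apply: contraT => nsub.
  suff /kmax : `[< free_in k.+1 >] by rewrite ltnn.
  apply/asboolP.
  exists (fun i : 'I_k.+1 => if unlift ord0 i is Some j then b j else v).
  split=> [i|]; first by case: unlift.
  have -> : coord_mx (fun i : 'I_k.+1 => if unlift ord0 i is Some j then b j else v)
      = col_mx (ch v) (coord_mx b) :> 'M[R]_(1 + k, n).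
    apply/row_matrixP => i; rewrite rowK; case: (unliftP ord0 i) => [j|] ->.
      have -> : lift ord0 j = rshift 1 j :> 'I_(1 + k) by exact/val_inj.
      by rewrite (@rowKd _ 1) rowK.
    have -> : ord0 = lshift k ord0 :> 'I_(1 + k) by exact/val_inj.
    by rewrite (@rowKu _ 1); apply/rowP => j; rewrite mxE.
  rewrite /row_free eqn_leq rank_leq_row -[leqLHS]add1n.
  have lt_rank : (coord_mx b < col_mx (ch v) (coord_mx b))%MS.
    by rewrite ltmxE -!addsmxE addsmxSr addsmx_sub (negbTE nsub).
  by apply: leq_trans (rank_ltmx lt_rank); rewrite (eqP bfree).
have full : row_full (coord_mx b).
  rewrite -sub1mx; apply/row_subP => i; rewrite row1 submxE.
  apply/eqP/rowP => j; rewrite [RHS]mxE -(coord_basis ch).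
  (* The functional is column [j] of the cokernel: it kills the span of [b], hence [S], and it is
     bounded. If its value [L] at [x] were nonzero, approximating [x] within |L| / (|C| + 1) would
     contradict the bound. *)
  have [C CP] := coord_functional_le (cokermx (coord_mx b)) j.
  set x := cbasis ch i; set L := _ 0 j.
  apply/eqP; rewrite -normr_eq0 eq_le normr_ge0 andbT leNgt; apply/negP => L0.
  have C1 : 0 < `|C| + 1 by rewrite ltr_wpDl.
  have [r [rS rx]] := dense x (`|L| / (`|C| + 1)) (divr_gt0 L0 C1).
  have := CP (x - \sum_(y <- r) y).
  have -> : (ch (x - \sum_(y <- r) y) *m cokermx (coord_mx b)) 0 j = L.
    have -> : x - \sum_(y <- r) y = (-1) *: \sum_(y <- r) y + x.
      by rewrite scaleN1r addrC.
    rewrite coordD coordZ mulmxDl -scalemxAl mxE [X in X + _]mxE -/L.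
    suff -> : ch (\sum_(y <- r) y) *m cokermx (coord_mx b) = 0.
      by rewrite mxE mulr0 add0r.
    rewrite coord_sum mulmx_suml big_seq big1// => y /rS/Ssub.
    by rewrite submxE => /eqP.
  rewrite leNgt => /negP; apply.
  apply: (@le_lt_trans _ _ (`|C| * `|x - \sum_(y <- r) y|)).
    by rewrite ler_wpM2r// ler_norm.
  move: rx; rewrite ltr_pdivlMr// => /(le_lt_trans _); apply.
  by rewrite mulrC ler_wpM2l// lerDl.
have kn : k = n by apply/eqP; rewrite -(eqP bfree) (eqP full).
clear ex0 ub kmax Ssub dense; subst k; exists b; split=> //.
by rewrite -unitfE -unitmxE -row_free_unit.
Qed.

End BasisFromDenseSpan.

(** * Cocycles of tempered growth *)

(** The two limits control [f] only outside a bounded interval; local boundedness supplies the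
    constant on the rest. *)
Lemma sublinear_of_limits (R : realType) (f : R -> R) (mu : R) :
    f t / t @[t --> +oo] --> mu -> f t / t @[t --> -oo] --> mu ->
    (forall N, exists C, forall t, `|t| <= N -> `|f t| <= C) ->
  sublinear (fun t => `|f t - mu * t|).
Proof.
move=> fp fm fb e e0.
have /fp : nbhs mu (ball mu e) by exact: nbhsx_ballx.
have /fm : nbhs mu (ball mu e) by exact: nbhsx_ballx.
move=> [Mm [_ /= Hm]] [Mp [_ /= Hp]].
pose N := `|Mm| + `|Mp| + 1.
have [C CP] := fb N.
exists (C + `|mu| * N) => t.
have N0 : 0 <= N by rewrite !addr_ge0.
have [tN|Nt] := lerP `|t| N.
  apply: le_trans (ler_normB _ _) _; rewrite normrM -[leLHS]addr0.
  by rewrite !lerD ?CP ?ler_wpM2l// mulr_ge0// ltW.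
have t0 : t != 0 by apply: contraTneq Nt => ->; rewrite normr0 -leNgt.
have : ball mu e (f t / t).
  have [tp|tn] := lerP 0 t; [apply: Hp|apply: Hm].
    rewrite ger0_norm// in Nt; apply: le_lt_trans Nt.
    by rewrite /N -addrA addrC -addrA ler_wpDr ?ler_norm// addr_ge0.
  rewrite ltr0_norm// /N in Nt.
  by have := ler_norm (- Mm); have := normr_ge0 Mp; rewrite normrN; lra.
rewrite -ball_normE /= => He.
have -> : f t - mu * t = - (mu - f t / t) * t.
  by rewrite opprB mulrBl divfK.
rewrite normrM normrN; apply: (@le_trans _ _ (e * `|t|)).
  by rewrite ler_wpM2r// ltW.
rewrite lerDr addr_ge0 ?mulr_ge0//.
by apply: le_trans (CP 0 _); rewrite ?normr0.
Qed.

Section LinearCocycle.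
Variables (R : realType) (T : Type) (theta : R -> T -> T).
Variables (H : normedModType R) (U : R -> T -> H -> H).
Hypotheses (flow0 : forall w, theta 0 w = w)
  (flowD : forall s t w, theta (s + t) w = theta s (theta t w))
  (U0 : forall w x, U 0 w x = x)
  (UD : forall t1 t2 w x, U (t1 + t2) w x = U t2 (theta t1 w) (U t1 w x))
  (U_linear : forall t w, linear (U t w)).

Lemma cocycleK t w x : U (- t) (theta t w) (U t w x) = x.
Proof. by rewrite -UD subrr U0. Qed.

Lemma cocycleNK t w x : U t w (U (- t) (theta t w) x) = x.
Proof.
by have := cocycleK (- t) (theta t w) x; rewrite -flowD addNr flow0 opprK.
Qed.

Lemma cocycle_eq0 t w (x : H) : (U t w x == 0) = (x == 0).
Proof.
have U00 s v : U s v 0 = 0.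
  by have := U_linear s v (-1) 0 0; rewrite scaler0 addr0 scaleN1r addNr.
apply/eqP/eqP => [Ux|->]; last exact: U00.
by rewrite -(cocycleK t w x) Ux.
Qed.

(** The pathwise form of the integrability condition. Negative [t] are included, so inverses are
    controlled too, and [s] is real, which makes the property invariant under the flow. *)
Definition tempered_growth w := forall e, 0 < e -> exists C,
  forall s t x, `|t| <= 1 -> `|U t (theta s w) x| <= expR (C + e * `|s|) * `|x|.

Lemma tempered_growth_flow r w : tempered_growth w -> tempered_growth (theta r w).
Proof.
move=> gw e e0; have [C CP] := gw e e0; exists (C + e * `|r|) => s t x t1.
rewrite -flowD; apply: le_trans (CP _ _ _ t1) _.
rewrite ler_wpM2r// ler_expR -addrA lerD2l -mulrDr ler_wpM2l ?(ltW e0)//.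
by rewrite addrC ler_normD.
Qed.

Lemma tempered_growth_bounded w (M : R) (N : nat) : tempered_growth w ->
  exists C, forall s t x, `|s| <= M -> `|t| <= N%:R ->
    `|U t (theta s w) x| <= expR C * `|x|.
Proof.
move=> gw; have [C CP] := gw 1 ltr01.
elim: N => [|N [D DP]].
  exists 0 => s t x _; rewrite normr_le0 => /eqP->.
  by rewrite U0 expR0 mul1r.
exists (D + (C + (M + N%:R))) => s t x sM tN.
have N1 : N.+1%:R != 0 :> R by rewrite pnatr_eq0.
have N10 : 0 < N.+1%:R :> R by rewrite ltr0n.
(* The last of N + 1 equal pieces of [t] is cut off; this treats both signs of [t] at once. *)
pose t1 := t / N.+1%:R * N%:R; pose t2 := t / N.+1%:R.
have tE : t = t1 + t2.
  by rewrite /t1 -[X in _ + X]mulr1 -mulrDr -natr1 -mulrA mulVf ?mulr1// natr1.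
have t21 : `|t2| <= 1 by rewrite normrM normfV ler_pdivrMr ?normr_gt0// normr_nat mul1r.
have t1N : `|t1| <= N%:R by rewrite normrM normr_nat ler_piMl.
rewrite [X in U X]tE UD; rewrite -flowD.
apply: le_trans (CP _ _ _ t21) _.
rewrite [D + _]addrC [in leRHS]expRD -mulrA ler_pM ?expR_ge0//; last exact: DP.
rewrite ler_expR lerD2l mul1r; apply: le_trans (ler_normD _ _) _.
by rewrite addrC lerD.
Qed.

Lemma tempered_growth_ln_bounded w (x : H) (N : R) : tempered_growth w -> x != 0 ->
  exists C, forall t, `|t| <= N -> `|ln `|U t w x| | <= C.
Proof.
move=> gw x0.
have [C CP] := tempered_growth_bounded (Num.bound `|N|)%:R (Num.bound `|N|) gw.
exists (`|ln `|x| | + `|C|) => t tN.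
have tN' : `|t| <= (Num.bound `|N|)%:R.
  by apply: (le_trans tN); rewrite (le_trans (ler_norm _))// ltW// archi_boundP.
have xp : 0 < `|x| by rewrite normr_gt0.
have Up : 0 < `|U t w x| by rewrite normr_gt0 cocycle_eq0.
have up : ln `|U t w x| <= C + ln `|x|.
  rewrite -ler_expR lnK ?posrE// expRD lnK ?posrE//.
  by have := CP 0 t x; rewrite flow0 normr0 => ->.
have lo : ln `|x| <= C + ln `|U t w x|.
  rewrite -ler_expR lnK ?posrE// expRD lnK ?posrE//.
  by have := CP t (- t) (U t w x); rewrite cocycleK normrN => ->.
rewrite ler_norml; have := ler_norm (ln `|x|); have := ler_norm (- ln `|x|).
by rewrite normrN; have := ler_norm C; lra.
Qed.

Lemma lyapunov_sublinear w (x : H) (mu : R) : tempered_growth w -> x != 0 ->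
    ln `|U t w x| / t @[t --> +oo] --> mu ->
    ln `|U t w x| / t @[t --> -oo] --> mu ->
  sublinear (fun t => `|ln `|U t w x| - mu * t|).
Proof.
move=> gw x0 lp lm; apply: sublinear_of_limits => // N.
exact: tempered_growth_ln_bounded.
Qed.

Variables (n : nat) (ch : chart H n).

Definition lndet t w := ln `|\det (chart_mx ch (U t w))|.

Lemma chart_mx_cocycle t1 t2 w : chart_mx ch (U (t1 + t2) w) =
  chart_mx ch (U t1 w) *m chart_mx ch (U t2 (theta t1 w)).
Proof.
by rewrite -chart_mx_comp//; congr chart_mx; apply/funext => x; exact: UD.
Qed.

Lemma det_cocycle_neq0 t w : \det (chart_mx ch (U t w)) != 0.
Proof.
have : \det (chart_mx ch (U (t - t) w)) = 1.
  have -> : U (t - t) w = id by apply/funext => x; rewrite subrr U0.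
  by rewrite chart_mx_id det1.
rewrite chart_mx_cocycle det_mulmx => /eqP.
by apply: contraTneq => ->; rewrite mul0r eq_sym oner_eq0.
Qed.

Lemma lndetD t1 t2 w : lndet (t1 + t2) w = lndet t1 w + lndet t2 (theta t1 w).
Proof.
rewrite /lndet chart_mx_cocycle det_mulmx normrM lnM// posrE normr_gt0;
  exact: det_cocycle_neq0.
Qed.

Lemma lndet0 w : lndet 0 w = 0.
Proof.
apply: (@addrI _ (lndet 0 w)).
by rewrite -[X in _ = lndet X w + 0]addr0 lndetD flow0 addr0.
Qed.

Lemma lndet_le t w C : (forall x, `|U t w x| <= expR C * `|x|) ->
  lndet t w <= ln n`!%:R + n%:R * C.
Proof.
move=> UC.
have n0 : (0 : R) < n`!%:R by rewrite ltr0n fact_gt0.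
rewrite /lndet -ler_expR lnK ?posrE ?normr_gt0 ?det_cocycle_neq0//.
rewrite expRD lnK ?posrE// [n%:R * C]mulrC expRM_natr.
have -> : expR C ^+ n = \prod_(i < n) expR C by rewrite prodr_const card_ord.
apply: normr_det_le => i j; rewrite mxE.
apply: le_trans (coord_le _ _ _) _.
by apply: le_trans (UC _) _; rewrite cbasis_norm mulr1.
Qed.

Lemma lndet_tempered w : tempered_growth w -> forall e, 0 < e ->
  exists C, forall s t, `|t| <= 1 -> `|lndet t (theta s w)| <= C + e * `|s|.
Proof.
move=> gw e e0.
(* A determinant costs [n] times the logarithm of the norm; dividing [e] by n + 1 also covers n =
   0. *)
have n0 : (0 : R) < n.+1%:R by rewrite ltr0n.
have [C CP] := gw (e / n.+1%:R) (divr_gt0 e0 n0).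
have one_sided s t : `|t| <= 1 ->
    lndet t (theta s w) <= ln n`!%:R + n%:R * `|C| + e * `|s|.
  move=> t1; apply: le_trans (lndet_le (fun x => CP s t x t1)) _.
  rewrite -addrA lerD2l mulrDr lerD ?ler_wpM2l ?ler_norm//.
  rewrite mulrA ler_wpM2r// mulrC mulrAC ler_pdivrMr// ler_wpM2l ?(ltW e0)//.
  by rewrite ler_nat.
exists (ln n`!%:R + n%:R * `|C| + e) => s t t1; rewrite ler_norml; apply/andP; split.
  (* The lower bound is the upper bound for the inverse, based at time t + s; the shift by at most 1
     accounts for the extra [e] in the constant. *)
  have := lndet0 (theta s w); rewrite -[X in lndet X](subrr t) lndetD -flowD.
  move=> /eqP; rewrite addr_eq0 => /eqP->; rewrite lerN2.
  apply: le_trans (one_sided _ _ _) _; first by rewrite normrN.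
  rewrite -[leRHS]addrA lerD2l -{2}[e]mulr1 -mulrDr ler_wpM2l ?(ltW e0)//.
  by apply: le_trans (ler_normD _ _) _; rewrite lerD2r.
by apply: le_trans (one_sided _ _ t1) _; rewrite lerD2r lerDl ltW.
Qed.

Lemma lndet_orbit_tempered w t : tempered_growth w -> forall e, 0 < e ->
  exists C, forall s, `|lndet t (theta s w)| <= C + e * `|s|.
Proof.
move=> gw.
(* The time is cut into N equal pieces of length at most 1. The quantifier over [e] stays inside the
   induction because each piece takes half of it. *)
suff multiple (N : nat) u : `|u| <= 1 -> forall e, 0 < e ->
    exists C, forall s, `|lndet (u * N%:R) (theta s w)| <= C + e * `|s|.
  pose N := (Num.bound `|t|).+1.
  have N0 : N%:R != 0 :> R by rewrite pnatr_eq0.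
  rewrite -[t](divfK N0); apply: multiple.
  rewrite normrM normfV normr_nat ler_pdivrMr ?ltr0n// mul1r.
  by rewrite (le_trans (ltW (archi_boundP _)))// ler_nat.
move=> u1; elim: N => [|N IH] e e0.
  exists 0 => s; rewrite mulr0 lndet0 normr0 add0r.
  by rewrite mulr_ge0// ltW.
have e20 : 0 < e / 2 by rewrite divr_gt0.
have [C CP] := IH _ e20; have [D DP] := lndet_tempered gw e20.
exists (C + D + e / 2 * `|u * N%:R|) => s.
rewrite -natr1 mulrDr mulr1 lndetD -flowD.
apply: le_trans (ler_normD _ _) _.
have := CP s; have := DP (u * N%:R + s) u u1.
have : e / 2 * `|u * N%:R + s| <= e / 2 * `|u * N%:R| + e / 2 * `|s|.
  by rewrite -mulrDr ler_wpM2l ?ler_normD// ltW.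
by lra.
Qed.

Lemma lndet_sublinear w delta : tempered_growth w ->
    (forall e, 0 < e -> exists C, forall m : int,
      `|lndet m%:~R w - delta * m%:~R| <= C + e * `|m%:~R|) ->
  sublinear (fun t => `|lndet t w - delta * t|).
Proof.
move=> gw dw e e0; have e20 : 0 < e / 2 by rewrite divr_gt0.
have [C CP] := lndet_tempered gw e20; have [D DP] := dw _ e20.
exists (C + D + `|delta| + e) => t.
set m := Num.floor t.
have mt : m%:~R <= t by exact: floor_le.
have tm : t < m%:~R + 1 by rewrite -intrD1 floorD1_gt.
have r1 : `|t - m%:~R| <= 1 by rewrite ler_norml; lra.
have m_le : `|m%:~R : R| <= `|t| + 1.
  rewrite -[m%:~R](subrK t) -opprB addrC.
  by apply: le_trans (ler_normB _ _) _; rewrite lerD2l.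
have -> : lndet t w - delta * t = (lndet m%:~R w - delta * m%:~R) +
    (lndet (t - m%:~R) (theta m%:~R w) - delta * (t - m%:~R)).
  have tE : t = m%:~R + (t - m%:~R) by rewrite addrC subrK.
  rewrite [in LHS]tE (lndetD m%:~R); move: (lndet _ _) (lndet _ _) => p q.
  by ring.
apply: le_trans (ler_normD _ _) _.
have := ler_normB (lndet (t - m%:~R) (theta m%:~R w)) (delta * (t - m%:~R)).
have : `|delta * (t - m%:~R)| <= `|delta| by rewrite normrM ler_piMr.
by have := CP m%:~R _ r1; have := DP m; nra.
Qed.

End LinearCocycle.

(** * The maximal ergodic theorem *)

Section MeasurePreserving.
Context d (T : measurableType d) (R : realType) (P : probability T R).

Definition measure_preserving (tau : T -> T) :=
  measurable_fun setT tau /\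
  forall A, measurable A -> P (tau @^-1` A) = P A.

Variable tau : T -> T.
Hypothesis tauP : measure_preserving tau.
Local Open Scope ereal_scope.

Let mtau : measurable_fun setT tau. Proof. by case: tauP. Qed.

Lemma ge0_integral_preserving (f : T -> \bar R) :
    measurable_fun setT f -> (forall w, 0 <= f w) ->
  \int[P]_w f (tau w) = \int[P]_w f w.
Proof.
move=> mf f0.
have := ge0_integral_pushforward mtau P measurableT mf (fun y _ => f0 y).
rewrite preimage_setT => <-.
by apply: eq_measure_integral => A mA _; case: tauP => _ /(_ A mA).
Qed.

Lemma integrable_preserving (f : T -> \bar R) :
  P.-integrable setT f -> P.-integrable setT (f \o tau).
Proof.
move=> /integrableP[mf foo]; apply/integrableP; split.
  exact: measurableT_comp.
rewrite (ge0_integral_preserving (f := fun w => `|f w|))//.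
exact: measurableT_comp.
Qed.

Lemma integral_preserving (f : T -> \bar R) : P.-integrable setT f ->
  \int[P]_w f (tau w) = \int[P]_w f w.
Proof.
move=> fi; have mf := measurable_int _ fi.
have fi' : P.-integrable (tau @^-1` setT) (f \o tau).
  by rewrite preimage_setT; exact: integrable_preserving.
have := integral_pushforward mtau mf fi' measurableT.
rewrite preimage_setT => <-.
by apply: eq_measure_integral => A mA _; case: tauP => _ /(_ A mA).
Qed.

End MeasurePreserving.

Section MaximalErgodic.
Context d (T : measurableType d) (R : realType) (P : probability T R).
Variable tau : T -> T.
Hypothesis tauP : measure_preserving P tau.
Variable a : T -> R.
Hypothesis a_int : P.-integrable setT (EFin \o a).

(** The maximum of the Birkhoff sums of [a] of lengths 0 to [n], written as the recursion that the
    maximal inequality uses. *)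
Fixpoint running_max n w : R :=
  if n is m.+1 then Num.max 0 (a w + running_max m (tau w)) else 0.

Lemma running_max_ge0 n w : 0 <= running_max n w.
Proof. by case: n => //= n; rewrite le_max lexx. Qed.

Lemma running_maxS n w : running_max n w <= running_max n.+1 w.
Proof.
elim: n w => [|n IH] w; first exact: running_max_ge0.
rewrite /= ge_max le_max lexx/= le_max; apply/orP; right.
by rewrite lerD2l; exact: IH.
Qed.

Lemma running_max_mono m n w : (m <= n)%N -> running_max m w <= running_max n w.
Proof.
move=> /subnK <-; elim: (n - m)%N => // k IH.
exact: le_trans IH (running_maxS _ _).
Qed.

Lemma running_max_integrable n : P.-integrable setT (EFin \o running_max n).
Proof.
elim: n => [|n IH]; first exact: integrable0.
have i2 : P.-integrable setT (EFin \o (fun w => a w + running_max n (tau w))).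
  have := integrableD measurableT a_int (integrable_preserving tauP IH).
  by apply: eq_integrable.
apply: (le_integrable measurableT _ _ i2).
  apply/measurable_EFinP; apply: measurable_maxr => //.
  by move: (measurable_int _ i2) => /measurable_EFinP.
move=> w _ /=; rewrite lee_fin ger0_norm ?le_max ?lexx//.
by rewrite ge_max normr_ge0 ler_norm.
Qed.

(** Garsia's argument. Where the maximum is positive it equals [a] plus the shorter maximum at
    [tau w], which is at most the longer one; elsewhere it is 0, and a nonnegative quantity is
    subtracted. *)
Lemma running_max_step n w :
  running_max n.+1 w - running_max n.+1 (tau w) <=
  a w * (if 0 < running_max n.+1 w then 1 else 0).
Proof.
have := running_maxS n (tau w); have := running_max_ge0 n.+1 (tau w).
have := running_max_ge0 n.+1 w.
case: ltP => [lt0 _ ge0 le|le0 ge0' ge0 _]; last by rewrite mulr0; lra.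
have : running_max n.+1 w = a w + running_max n (tau w).
  by move: lt0 => /=; rewrite lt_max ltxx/= => /ltW/max_idPr.
by lra.
Qed.

Local Open Scope ereal_scope.

Let pos n : set T := [set w | (0 < running_max n w)%R].

Let mpos n : measurable (pos n).
Proof.
have : measurable_fun setT (running_max n).
  by have := measurable_int _ (running_max_integrable n) => /measurable_EFinP.
move=> mM; have -> : pos n = running_max n @^-1` `]0%R, +oo[.
  by apply/seteqP; split => w /=; rewrite in_itv/= andbT.
by rewrite -[_ @^-1` _]setTI; exact: mM.
Qed.

Let a_pos n w : R := (a w * (if (0 < running_max n w)%R then 1 else 0))%R.

Let ma : measurable_fun setT a.
Proof. by have := measurable_int _ a_int => /measurable_EFinP. Qed.

Let ma_pos n : measurable_fun setT (a_pos n).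
Proof.
have -> : a_pos n = (a \* \1_(pos n))%R.
  apply/funext => w; rewrite /a_pos /= indicE.
  have -> : (w \in pos n) = (0 < running_max n w)%R by apply/idP/idP; rewrite inE.
  by case: (0 < running_max n w)%R.
by apply: measurable_funM => //; exact: measurable_indic.
Qed.

Let a_pos_le n w : (`|a_pos n w| <= `|a w|)%R.
Proof. by rewrite /a_pos; case: ifP => _; rewrite ?mulr1// mulr0 normr0. Qed.

Let a_pos_int n : P.-integrable setT (EFin \o a_pos n).
Proof.
apply: (le_integrable measurableT _ _ a_int); first exact/measurable_EFinP.
by move=> w _ /=; rewrite lee_fin a_pos_le.
Qed.

Let a_pos_ge0 n : 0 <= \int[P]_w (a_pos n.+1 w)%:E.
Proof.
have Mi := running_max_integrable n.+1.
have Mi' := integrable_preserving tauP Mi.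
have : \int[P]_w ((EFin \o running_max n.+1) \- (EFin \o running_max n.+1 \o tau)) w = 0.
  rewrite (integralB measurableT Mi Mi') (integral_preserving tauP Mi).
  by apply: subee; exact: integrable_fin_num.
move=> <-; apply: le_integral; [exact: measurableT|exact: integrableB|exact: a_pos_int|].
by move=> w _; rewrite /= -EFinB lee_fin; exact: running_max_step.
Qed.

(** Both terms on the left of [running_max_step] have the same integral, so [a] has nonnegative
    integral over the set where the maximum is positive. These sets increase to a set of full
    measure, and |a| dominates. *)
Lemma maximal_ergodic :
    {ae P, forall w, exists n, (0 < running_max n w)%R} ->
  0 <= \int[P]_w (a w)%:E.
Proof.
move=> aepos.
have ae_cvg : {ae P, forall w, setT w -> (EFin \o a_pos n.+1) w @[n --> \oo] --> (EFin \o a) w}.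
  apply: filterS aepos => w [n Mn] _; apply: cvg_near_cst; exists n => // m /= nm.
  rewrite /a_pos (lt_le_trans Mn) ?mulr1//.
  by apply: running_max_mono; rewrite (leq_trans nm).
have dom : {ae P, forall w n, setT w -> `|(EFin \o a_pos n.+1) w| <= `|(EFin \o a) w|}.
  by apply/aeW => w n _ /=; rewrite lee_fin a_pos_le.
have [_ _ cvga] := dominated_convergence measurableT
  (fun n => measurable_int _ (a_pos_int n.+1)) (measurable_int _ a_int) ae_cvg
  (integrable_abse a_int) dom.
have := cvg_lim (@ereal_hausdorff R) cvga => <-.
apply: lime_ge; first by apply/cvg_ex; eexists; exact: cvga.
by apply: nearW => n /=; exact: a_pos_ge0.
Qed.

End MaximalErgodic.

(** Powers of 1/2 replace a positive [e] wherever a countable quantifier is needed. *)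
Lemma half_exp_lt (R : realType) (e : R) : 0 < e -> exists k, 2^-1 ^+ k < e.
Proof.
move=> e0; exists (Num.bound e^-1).
have := archi_boundP (ltW (_ : 0 < e^-1)); rewrite invr_gt0 => /(_ e0) eb.
rewrite exprVn invf_plt ?posrE ?exprn_gt0//; apply: (lt_trans eb).
by rewrite -natrX ltr_nat ltn_expl.
Qed.

(** * Almost sure statements and growth along orbits *)

Section FullMeasure.
Context d (T : measurableType d) (R : realType) (P : probability T R).

(** Completeness is what makes sets that are described path by path, such as that of tempered
    growth, measurable. *)
Lemma ae_complete_full (P_complete : measure_is_complete P) (A : set T) :
  {ae P, forall w, A w} -> measurable A /\ P A = 1%E.
Proof.
move=> aeA; have mA : measurable A.
  by rewrite -[A]setCK; apply: measurableC; exact: P_complete.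
split=> //; have := probability_setC P (measurableC mA).
rewrite setCK => ->; have /negligibleP -> := aeA; first by rewrite sube0.
exact: measurableC.
Qed.

Lemma full_ae (A : set T) : measurable A -> P A = 1%E -> {ae P, forall w, A w}.
Proof.
move=> mA PA; apply/negligibleP; first exact: measurableC.
by have := probability_setC P mA; rewrite PA subee.
Qed.

End FullMeasure.

Section OrbitGrowth.
Context d (T : measurableType d) (R : realType) (P : probability T R).

Lemma sum_nat_indicator_le (y : R) N : 0 <= y ->
  \sum_(n < N) (if n.+1%:R < y then 1 else 0) <= y.
Proof.
move=> y0; elim: N => [|N IH]; first by rewrite big_ord0.
rewrite big_ord_recr /=; case: ltP => [Ny|_]; last by rewrite addr0.
apply: le_trans (ltW Ny); rewrite -natr1 lerD2r.
apply: (@le_trans _ _ (\sum_(n < N) 1)).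
  by apply: ler_sum => n _; case: ifP.
by rewrite sumr_const card_ord.
Qed.

(** Borel-Cantelli: by invariance the probabilities of f > e (n + 1) add up to at most E f / e. The
    maps [tau n] may be any measure-preserving maps, so forward and backward times are both
    covered. *)
Lemma ae_orbit_sublinear (tau : nat -> T -> T) (f : T -> R) :
    (forall n, measure_preserving P (tau n)) ->
    P.-integrable setT (EFin \o f) -> (forall w, 0 <= f w) ->
  {ae P, forall w e, 0 < e -> exists C, forall n, f (tau n w) <= C + e * n%:R}.
Proof.
move=> tauP fi f0.
have mf : measurable_fun setT f by have := measurable_int _ fi => /measurable_EFinP.
pose above (e : R) n := [set w | e * n.+1%:R < f w].
have mabove e n : measurable (above e n).
  have -> : above e n = f @^-1` `]e * n.+1%:R, +oo[.
    by apply/seteqP; split => w /=; rewrite in_itv/= andbT.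
  by rewrite -[_ @^-1` _]setTI; exact: mf.
have null (e : R) : 0 < e -> {ae P, forall w, exists N, forall n, (N <= n)%N ->
    f (tau n w) <= e * n.+1%:R}.
  move=> e0.
  have mF n : measurable (tau n @^-1` above e n).
    by case: (tauP n) => mt _; rewrite -[_ @^-1` _]setTI; exact: mt.
  have sumF : (\sum_(n <oo) P (tau n @^-1` above e n) < +oo)%E.
    apply: (@le_lt_trans _ _ (\int[P]_w (e^-1 * f w)%:E)%E); last first.
      by apply: integrable_lty => //; have := integrableZl measurableT e^-1 fi; apply: eq_integrable.
    apply: lime_le; first by apply: is_cvg_nneseries => n _ _; exact: measure_ge0.
    apply: nearW => N.
    pose g w : R := \sum_(n < N) \1_(above e n) w.
    have mg : measurable_fun setT g.
      by apply: measurable_sum => n; exact: measurable_indic.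
    have -> : (\sum_(0 <= n < N) P (tau n @^-1` above e n) = \int[P]_w (g w)%:E)%E.
      rewrite /g; under eq_integral do rewrite -sumEFin.
      rewrite ge0_integral_sum//=; last first.
        by move=> n; apply/measurable_EFinP; exact: measurable_indic.
      rewrite big_mkord; apply: eq_bigr => n _; rewrite integral_indic// setIT.
      by case: (tauP n) => _ ->.
    apply: ge0_le_integral => //.
    - by move=> w _; rewrite lee_fin sumr_ge0.
    - exact/measurable_EFinP.
    - by apply/measurable_EFinP; exact: measurable_funM.
    move=> w _; rewrite lee_fin.
    apply: le_trans (sum_nat_indicator_le N (_ : 0 <= e^-1 * f w)).
      apply: ler_sum => n _; rewrite indicE.
      have -> : (w \in above e n) = (n.+1%:R < e^-1 * f w).
        by apply/idP/idP; rewrite inE /above /= ltr_pdivlMl.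
      by case: ifP.
    by rewrite mulr_ge0// invr_ge0 ltW.
  exists (lim_sup_set (fun n => tau n @^-1` above e n)); split.
  - by apply: bigcapT_measurable => N; exact: bigcup_measurable.
  - exact: lim_sup_set_cvg0.
  move=> w /= nw N _; apply: contrapT => nN; apply: nw; exists N => n Nn.
  by rewrite leNgt; apply/negP => lt; apply: nN; exists n.
have half0 : 0 < 2^-1 :> R by rewrite invr_gt0.
have := ae_foralln (fun k => null (2^-1 ^+ k) (exprn_gt0 k half0)).
apply: filterS => w Hw e e0.
have [k ke] := half_exp_lt e0.
have [N HN] := Hw k.
(* The sum covers the finitely many times before [N]; the summand [e] turns n + 1 into n. *)
exists (e + \sum_(i < N) f (tau i w)) => n.
have [Nn|nN] := leqP N n.
  apply: (le_trans (HN n Nn)).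
  have S0 : 0 <= \sum_(i < N) f (tau i w) by exact: sumr_ge0.
  have : 2^-1 ^+ k * n.+1%:R <= e * n.+1%:R by rewrite ler_wpM2r// ltW.
  by rewrite -natr1; lra.
rewrite (bigD1 (Ordinal nN))//=; have : 0 <= \sum_(i < N | i != Ordinal nN) f (tau i w).
  exact: sumr_ge0.
by have : 0 <= e * n%:R by [rewrite mulr_ge0// ltW]; lra.
Qed.

(** * An ergodic upper bound for additive cocycles *)

Section ErgodicUpperBound.
Variable theta : R -> T -> T.
Hypothesis theta_flow : ergodic_flow P theta.

Let preserving t : measure_preserving P (theta t).
Proof. by split; [exact: (flow_measurable theta_flow)|exact: (flow_preserving theta_flow)]. Qed.

Variables (A : set T) (s : R) (f : nat -> T -> R).
Hypotheses (mA : measurable A) (PA : P A = 1%E)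
  (A_inv : forall r w, A w -> A (theta r w)).
Hypotheses (f0 : forall w, f 0%N w = 0)
  (fS : forall n w, f n.+1 w = f 1%N w + f n (theta s w))
  (mf : forall n, measurable_fun setT (f n))
  (f_int : P.-integrable setT (EFin \o f 1%N))
  (f_flow : forall w r, A w -> forall e, 0 < e -> exists C, forall n,
    `|f n (theta r w) - f n w| <= C + e * n%:R).

Let m := fine (\int[P]_w (f 1%N w)%:E).

(** The event that the upper limit of f_n / n is larger than [c]. The margin 2^-j is explicit so
    that moving along the flow may consume half of it. *)
Let exceeds (c : R) w := A w /\ exists j, forall N, exists n,
  (N <= n)%N /\ (c + 2^-1 ^+ j) * n%:R < f n w.

Let exceeds_flow c r w : exceeds c w -> exceeds c (theta r w).
Proof.
move=> [Aw [j jP]]; split; first exact: A_inv.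
exists j.+1 => N.
have q0 : 0 < 2^-1 ^+ j :> R by rewrite exprn_gt0.
(* One quarter of the margin pays for the slope of the error and one quarter, for large [n], for its
   constant; the other half is the margin 2^-(j+1) at [theta r w]. *)
have e0 : 0 < 2^-1 ^+ j / 4 :> R by rewrite divr_gt0.
have [C CP] := f_flow r Aw e0.
have [n [nN fn]] := jP (maxn N (Num.bound (`|C| / (2^-1 ^+ j / 4)))).
rewrite geq_max in nN; case/andP: nN => Nn nb.
exists n; split=> //.
have Cn : C <= 2^-1 ^+ j / 4 * n%:R.
  apply: (le_trans (ler_norm C)); rewrite mulrC -ler_pdivrMr//.
  apply: (le_trans (ltW (archi_boundP _))); first by rewrite divr_ge0// ltW.
  by rewrite ler_nat.
have := CP n; rewrite ler_norml => /andP[+ _]; rewrite exprS.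
by lra.
Qed.

Let m_exceeds c : measurable (exceeds c).
Proof.
have -> : exceeds c = A `&` \bigcup_j \bigcap_N \bigcup_(n in [set n | (N <= n)%N])
    f n @^-1` `](c + 2^-1 ^+ j) * n%:R, +oo[.
  apply/seteqP; split => w.
    move=> [Aw [j jP]]; split=> //; exists j => // N _; have [n [Nn fn]] := jP N.
    by exists n => //=; rewrite in_itv/= andbT.
  move=> [Aw [j _ jP]]; split=> //; exists j => N; have [n /= Nn] := jP N I.
  by rewrite in_itv/= andbT => fn; exists n.
apply: measurableI => //; apply: bigcupT_measurable => j.
apply: bigcapT_measurable => N; apply: bigcup_measurable => n _.
by rewrite -[_ @^-1` _]setTI; exact: mf.
Qed.

Let le_running_max c n w :
  f n w - c * n%:R <= running_max (theta s) (fun w => f 1%N w - c) n w.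
Proof.
elim: n w => [|n IH] w; first by rewrite f0 mulr0 subrr.
rewrite /= le_max; apply/orP; right.
by have := IH (theta s w); rewrite fS -natr1; lra.
Qed.

(** By ergodicity of the flow the event has probability 0 or 1. If 1, the sums of f_1 - c become
    positive almost surely, and the maximal ergodic theorem gives c <= m. *)
Let exceeds_null c : m < c -> P (exceeds c) = 0%E.
Proof.
move=> mc; have inv t : theta t @^-1` exceeds c = exceeds c.
  apply/seteqP; split => w /=; last exact: exceeds_flow.
  move=> /(exceeds_flow (- t)); rewrite -(flowD theta_flow) addNr.
  by rewrite (flow0 theta_flow).
have [//|P1] := flow_ergodic theta_flow (m_exceeds c) inv.
have c_int : P.-integrable setT (EFin \o cst c).
  exact: finite_measure_integrable_cst.
have fc_int : P.-integrable setT (EFin \o (fun w => f 1%N w - c)).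
  by have := integrableB measurableT f_int c_int; apply: eq_integrable.
have := maximal_ergodic (preserving s) fc_int.
have -> : (\int[P]_w (f 1%N w - c)%:E)%E = (m - c)%:E.
  under eq_integral do rewrite EFinB.
  rewrite (integralB measurableT f_int c_int)/= integral_cst//.
  rewrite [X in (_ - X)%E](_ : _ = c%:E); last first.
    by apply: etrans (mule1 _); congr (_ * _)%E; exact: probability_setT.
  by rewrite EFinB /m fineK//; exact: integrable_fin_num.
rewrite lee_fin subr_ge0 leNgt mc => /(_ _)/negP; case.
  apply: filterS (full_ae (m_exceeds c) P1) => w [_ [j /(_ 1%N)[n [n1 fn]]]].
  exists n; apply: lt_le_trans (le_running_max c n w).
  rewrite subr_gt0; apply: le_lt_trans fn; rewrite ler_wpM2r// lerDl.
  by rewrite exprn_ge0.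
by [].
Qed.

(** Applied to a cocycle and to its negative, this gives the convergence of time averages to the
    mean. *)
Lemma ergodic_upper_bound :
  {ae P, forall w e, 0 < e -> exists C, forall n, f n w <= C + (m + e) * n%:R}.
Proof.
have null k : {ae P, forall w, ~ exceeds (m + 2^-1 ^+ k) w}.
  exists (exceeds (m + 2^-1 ^+ k)); split => //.
    by apply: exceeds_null; rewrite ltrDl exprn_gt0.
  by move=> w /= /contrapT.
apply: filterS2 (full_ae mA PA) (ae_foralln null) => w Aw nw e e0.
have e20 : 0 < e / 2 by rewrite divr_gt0.
have [k ke] := half_exp_lt e20.
have [N NP] : exists N, forall n, (N <= n)%N -> f n w <= (m + e) * n%:R.
  apply: contrapT => nN; apply: (nw k); split=> //; exists k => N.
  apply: contrapT => nn; apply: nN; exists N => n Nn.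
  rewrite leNgt; apply/negP => lt; apply: nn; exists n; split=> //.
  apply: le_lt_trans lt; rewrite ler_wpM2r//; lra.
exists (\sum_(i < N) `|f i w - (m + e) * i%:R|) => n.
rewrite -lerBlDr; have [Nn|nN] := leqP N n.
  by apply: (@le_trans _ _ 0); [rewrite subr_le0 NP|rewrite sumr_ge0].
rewrite (bigD1 (Ordinal nN))//=; apply: (le_trans (ler_norm _)).
by rewrite lerDl sumr_ge0.
Qed.

End ErgodicUpperBound.

End OrbitGrowth.

(** * Tempered growth from log-integrability *)

Lemma logp_ge0 (R : realType) (x : \bar R) : (0 <= logp x)%E.
Proof. by rewrite /logp le_max lexx orbT. Qed.

Lemma logp_le_expR (R : realType) (x : \bar R) (l : R) :
  (logp x <= l%:E)%E -> (x <= (expR l)%:E)%E.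
Proof.
rewrite /logp ge_max => /andP[].
case: x => [r| |]; rewrite ?leNye//; have [r0 _ _|r0] := leP r 0.
  by rewrite lee_fin (le_trans r0)// expR_ge0.
by rewrite lne_EFin// lee_fin -ler_expR lnK ?posrE.
Qed.

Section OperatorNorm.
Variables (R : realType) (H : normedModType R).
Implicit Types (E : set H) (f : H -> H).

Lemma opnorm_onP E f C : linear f -> (forall a x, E x -> E (a *: x)) -> 0 <= C ->
  (opnorm_on E f <= C%:E)%E <-> forall x, E x -> `|f x| <= C * `|x|.
Proof.
move=> lf EZ C0; split => [fC x Ex|fC]; last first.
  apply: ge_ereal_sup => _ [x [Ex x1] <-]; rewrite lee_fin.
  by apply: le_trans (fC x Ex) _; rewrite ler_piMr.
have fZ a y : f (a *: y) = a *: f y.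
  have := lf a y 0; rewrite !addr0 => ->.
  by have := lf (-1) 0 0; rewrite scaler0 addr0 scaleN1r addNr => ->; rewrite addr0.
have [->|x0] := eqVneq x 0.
  by have := fZ 0 0; rewrite !scale0r => ->; rewrite !normr0 mulr0.
have nx0 : 0 < `|x| by rewrite normr_gt0.
have : ((`|f (`|x|^-1 *: x)|)%:E <= opnorm_on E f)%E.
  apply: ereal_sup_ubound; exists (`|x|^-1 *: x) => //; split; first exact: EZ.
  by rewrite normrZ normfV normr_id mulVf ?gt_eqF.
move=> /le_trans /(_ fC); rewrite lee_fin fZ normrZ normfV normr_id.
by rewrite mulrC ler_pdivrMr.
Qed.

Lemma log_sup_opnorm_bound (g : R -> H -> H) (l : R) : (forall t, linear (g t)) ->
    (logp (ereal_sup [set opnorm (g t) | t in `[0%R, 1%R]]) <= l%:E)%E ->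
  forall t x, 0 <= t <= 1 -> `|g t x| <= expR l * `|x|.
Proof.
move=> lg /logp_le_expR gl t x t01.
have [+ _] := opnorm_onP (E := setT) (lg t) (fun _ _ _ => I) (expR_ge0 l).
apply=> //; apply: le_trans gl; apply: ereal_sup_ubound; exists t => //=.
Qed.

End OperatorNorm.

(** Three of the integrable logarithms, added up: each is nonnegative, hence below the sum. The
    second reaches time 1 from an intermediate point of the orbit, and the third bounds inverses. *)
Definition log_growth (R : realType) (T : Type) (theta : R -> T -> T)
    (H : normedModType R) (U : R -> T -> H -> H) (w : T) : \bar R :=
  (logp (ereal_sup [set opnorm (rds_plus U t w) | t in `[0%R, 1%R]]) +
  logp (ereal_sup [set opnorm (rds_plus U (1 - t) (theta t w)) | t in `[0%R, 1%R]]) +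
  logp (ereal_sup [set opnorm (rds_minus U t w) | t in `[0%R, 1%R]]))%E.

Lemma log_growth_ge0 (R : realType) (T : Type) (theta : R -> T -> T)
    (H : normedModType R) (U : R -> T -> H -> H) (w : T) :
  (0 <= log_growth theta U w)%E.
Proof. by rewrite !adde_ge0 ?logp_ge0. Qed.

Section TemperedGrowthAlmostEverywhere.
Context d (T : measurableType d) (R : realType) (P : probability T R).
Variables (theta : R -> T -> T) (theta_flow : ergodic_flow P theta).
Variables (H : completeNormedModType R) (U : R -> T -> H -> H).
Hypotheses (U_rds : linear_rds theta U)
  (U_int_plus : log_integrable P theta (rds_plus U))
  (U_int_minus : log_integrable P theta (rds_minus U)).

Let preserving t : measure_preserving P (theta t).
Proof. by split; [exact: (flow_measurable theta_flow)|exact: (flow_preserving theta_flow)]. Qed.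

Local Notation log_growth := (log_growth theta U).

Lemma log_growth_integrable : P.-integrable setT log_growth.
Proof.
case: U_int_plus U_int_minus => ip1 ip2 [im _].
by apply: (integrableD measurableT _ im); exact: integrableD.
Qed.

Lemma fine_log_growth_integrable : P.-integrable setT (EFin \o (fine \o log_growth)).
Proof.
apply: (le_integrable measurableT _ _ log_growth_integrable).
  apply/measurable_EFinP; apply: measurableT_comp => //.
  exact: (measurable_int _ log_growth_integrable).
move=> w _ /=; have := log_growth_ge0 theta U w.
by case: (log_growth w) => [r| |] //= _; rewrite ?leey.
Qed.

Lemma log_growth_bounds w : log_growth w \is a fin_num ->
  forall t x, 0 <= t <= 1 ->
  [/\ `|U t w x| <= expR (fine (log_growth w)) * `|x|,
      `|U (1 - t) (theta t w) x| <= expR (fine (log_growth w)) * `|x| &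
      `|U (- t) w x| <= expR (fine (log_growth w)) * `|x|].
Proof.
move=> fw t x t01; have lU := rds_linear U_rds.
split.
- apply: (log_sup_opnorm_bound (g := fun t => rds_plus U t w)) => //.
  by rewrite fineK// /log_growth -addeA leeDl// adde_ge0 ?logp_ge0.
- apply: (log_sup_opnorm_bound (g := fun t => rds_plus U (1 - t) (theta t w))) => //.
  by rewrite fineK// /log_growth addeAC leeDr// adde_ge0 ?logp_ge0.
- apply: (log_sup_opnorm_bound (g := fun t => rds_minus U t w)) => // [s|].
    exact: lU.
  by rewrite fineK// /log_growth leeDr// adde_ge0 ?logp_ge0.
Qed.

Let thetaD := flowD theta_flow.
Let UD := rdsD U_rds.

Lemma unit_time_bound w t x : `|t| <= 1 -> log_growth w \is a fin_num ->
  `|U t w x| <= expR (fine (log_growth w)) * `|x|.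
Proof.
move=> t1 fw; have [t0|t0] := leP 0 t.
  have t01 : 0 <= t <= 1 by rewrite t0 -[t]ger0_norm.
  by have [] := log_growth_bounds fw x t01.
have t01 : 0 <= - t <= 1 by rewrite -ltr0_norm// normr_ge0.
by have [_ _] := log_growth_bounds fw x t01; rewrite opprK.
Qed.

(** Only integer base points are controlled, so the path from [theta r w] first runs to [theta 1 w]
    and continues from there. *)
Lemma unit_step_bound w r t x : 0 <= r <= 1 -> `|t| <= 1 ->
    log_growth w \is a fin_num -> log_growth (theta 1 w) \is a fin_num ->
  `|U t (theta r w) x| <=
  expR (2 * fine (log_growth w) + 2 * fine (log_growth (theta 1 w))) * `|x|.
Proof.
move=> r01 t1 fw fw1.
set l := fine _; set l1 := fine _.
have l0 : 0 <= l by rewrite fine_ge0// log_growth_ge0.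
have l10 : 0 <= l1 by rewrite fine_ge0// log_growth_ge0.
have [_ y_le _] := log_growth_bounds fw x r01.
set y := U (1 - r) (theta r w) x in y_le.
(* The remaining time lies in [-2, 1] and takes one step, or two when it is below -1. *)
pose q := t - (1 - r).
have -> : U t (theta r w) x = U q (theta 1 w) y.
  have -> : theta 1 w = theta (1 - r) (theta r w) by rewrite -thetaD subrK.
  by rewrite /y -UD /q addrC subrK.
have [q0 q2] : q <= 1 /\ -2 <= q.
  by move: t1 r01; rewrite ler_norml /q => /andP[? ?] /andP[? ?]; split; lra.
have two_steps p : p <= l1 + (l1 + l) -> `|U q (theta 1 w) y| <= expR p * `|y| ->
    `|U q (theta 1 w) y| <= expR (2 * l + 2 * l1) * `|x|.
  move=> pl /le_trans; apply.
  apply: (@le_trans _ _ (expR p * (expR l * `|x|))); first by rewrite ler_wpM2l ?expR_ge0.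
  by rewrite mulrA -expRD ler_wpM2r// ler_expR; lra.
have [q_ge0|q_lt0] := leP 0 q.
  apply: (two_steps l1); first by lra.
  by have [] := log_growth_bounds fw1 y (ltac:(lra) : 0 <= q <= 1).
have [q1|q1] := leP (-1) q.
  apply: (two_steps l1); first by lra.
  by have [_ _] := log_growth_bounds fw1 y (ltac:(lra) : 0 <= - q <= 1); rewrite opprK.
(* The first step leads back from [theta 1 w] to [w], and the second starts at [w]. *)
apply: (two_steps (l1 + l)); first by lra.
have -> : U q (theta 1 w) y = U (q + 1) w (U (-1) (theta 1 w) y).
  have {2}-> : w = theta (- 1) (theta 1 w) by rewrite -thetaD addNr (flow0 theta_flow).
  by rewrite -UD addrCA addNr addr0.
have [_ _ b0] := log_growth_bounds fw (U (-1) (theta 1 w) y)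
  (ltac:(lra) : 0 <= - (q + 1) <= 1).
have [_ _ b1] := log_growth_bounds fw1 y (ltac:(by rewrite ler01 lexx) : 0 <= (1 : R) <= 1).
rewrite opprK in b0; apply: (le_trans b0); rewrite addrC expRD -mulrA.
by rewrite ler_wpM2l ?expR_ge0.
Qed.

Lemma ae_log_growth_fin (tau : nat -> R) :
  {ae P, forall w n, log_growth (theta (tau n) w) \is a fin_num}.
Proof.
apply: ae_foralln => n.
have := integrable_ae measurableT
  (integrable_preserving (preserving (tau n)) log_growth_integrable).
by apply: filterS => w /= /(_ I).
Qed.

Lemma ae_log_growth_int :
  {ae P, forall w, (forall k : int, log_growth (theta k%:~R w) \is a fin_num) /\
    forall e, 0 < e -> exists C, forall k : int,
      fine (log_growth (theta k%:~R w)) <= C + e * `|k%:~R|}.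
Proof.
pose up n : R := n%:R; pose dn n : R := - n%:R.
have fge0 w : 0 <= fine (log_growth w) by rewrite fine_ge0// log_growth_ge0.
have sub (tau : nat -> R) := ae_orbit_sublinear (fun n => preserving (tau n))
  fine_log_growth_integrable fge0.
have uf := ae_log_growth_fin up; have df := ae_log_growth_fin dn.
have us := sub up; have ds := sub dn.
apply: filterS2 (filterI uf df) (filterI us ds) => w [fu fd] [su sd]; split.
  move=> [n|n]; first by have := fu n.
  by have := fd n.+1; rewrite NegzE /dn mulrNz.
move=> e e0; have [C CP] := su e e0; have [D DP] := sd e e0.
exists (`|C| + `|D|) => -[n|n].
  have := CP n; rewrite /up /= -[Posz n]/(n%:Z) => /le_trans; apply.
  by rewrite -pmulrn normr_nat lerD2r (le_trans (ler_norm C))// lerDl.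
have := DP n.+1; rewrite /dn NegzE mulrNz -pmulrn normrN normr_nat => /le_trans; apply.
by rewrite lerD2r (le_trans (ler_norm D))// lerDr.
Qed.

Lemma ae_tempered_growth : {ae P, forall w, tempered_growth theta U w}.
Proof.
apply: filterS ae_log_growth_int => w [fin sub] e e0.
have e40 : 0 < e / 4 by rewrite divr_gt0.
have [C CP] := sub _ e40.
(* Four logarithms occur, each at most C + (e / 4) (|s| + 2), since both integers around [s] are
   within |s| + 2 of 0. *)
exists (4 * C + 2 * e) => s t x t1.
set k := Num.floor s.
have ks : k%:~R <= s by exact: floor_le.
have sk : s < k%:~R + 1 by rewrite -intrD1 floorD1_gt.
have -> : theta s w = theta (s - k%:~R) (theta k%:~R w) by rewrite -thetaD subrK.
have k1 : theta 1 (theta k%:~R w) = theta (k + 1)%:~R w by rewrite -thetaD intrD1 addrC.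
apply: le_trans (unit_step_bound x _ t1 (fin k) _) _; first by lra.
  by rewrite k1 fin.
rewrite ler_wpM2r// ler_expR k1.
have n1 : `|k%:~R : R| <= `|s| + 2.
  by have := ler_norm s; have := ler_norm (- s); rewrite ler_norml normrN; lra.
have n2 : `|(k + 1)%:~R : R| <= `|s| + 2.
  by have := ler_norm s; have := ler_norm (- s); rewrite ler_norml normrN intrD1; lra.
have := CP k; have := CP (k + 1).
have : e / 4 * `|k%:~R| <= e / 4 * (`|s| + 2) by rewrite ler_wpM2l// ltW.
have : e / 4 * `|(k + 1)%:~R| <= e / 4 * (`|s| + 2) by rewrite ler_wpM2l// ltW.
by lra.
Qed.

End TemperedGrowthAlmostEverywhere.

(** * Growth of the determinant *)

Lemma lipschitz_bound_continuous (R : realType) (H : normedModType R) (g : H -> R) C :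
  (forall x y, `|g x - g y| <= C * `|x - y|) -> continuous g.
Proof.
move=> lg x; apply/cvgrPdist_lt => e e0.
have C1 : 0 < `|C| + 1 by rewrite ltr_wpDl.
near=> y; apply: le_lt_trans (lg x y) _.
apply: (@le_lt_trans _ _ ((`|C| + 1) * `|x - y|)).
  by rewrite ler_wpM2r// (le_trans (ler_norm C))// lerDl.
rewrite mulrC -ltr_pdivlMr//; near: y.
by apply: (@cvgr_dist_lt _ _ _ _ _ id x) => //; rewrite divr_gt0.
Unshelve. all: by end_near. Qed.

Lemma borel_measurable_continuous (R : realType) (H : normedModType R) (g : H -> R) :
  continuous g -> measurable_fun setT (g : borel H -> R).
Proof.
move=> cg; apply: (measurability _ (RGenOpens.measurableE R)) => _ [_ [a [b ->] <-]].
rewrite setTI; apply: sub_sigma_algebra.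
by move/continuousP : cg; apply; exact: interval_open.
Qed.

Section CocycleMeasurability.
Context d (T : measurableType d) (R : realType).
Variables (theta : R -> T -> T) (H : completeNormedModType R) (U : R -> T -> H -> H).
Hypothesis U_rds : linear_rds theta U.

Lemma measurable_cocycle t x : measurable_fun setT ((fun w => U t w x) : T -> borel H).
Proof.
have mp : measurable_fun setT
    (fun w : T => (((t : measurableTypeR R), w), (x : borel H))).
  by apply: measurable_fun_pair => //; exact: measurable_fun_pair.
exact: (measurableT_comp (rds_measurable U_rds) mp).
Qed.

Lemma measurable_norm_cocycle t x : measurable_fun setT (fun w => `|U t w x|).
Proof.
apply: (measurableT_comp (f := fun x : borel H => `|x : H|)); last exact: measurable_cocycle.
by apply: borel_measurable_continuous => y; exact: norm_continuous.
Qed.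

Variables (n : nat) (ch : chart H n).

Lemma measurable_lndet t : measurable_fun setT (lndet U ch t).
Proof.
apply: measurableT_comp; first exact: measurable_ln.
apply: measurableT_comp => //.
apply: measurable_sum => s; apply: measurable_funM => //.
apply: measurable_prod => i _.
have -> : (fun w => chart_mx ch (U t w) i (s i)) =
    (fun x : borel H => ch x 0 (s i)) \o (fun w => U t w (cbasis ch i)).
  by apply/funext => w; rewrite mxE.
apply: measurableT_comp; last exact: measurable_cocycle.
apply: borel_measurable_continuous; apply: (lipschitz_bound_continuous (C := 1)) => x y; rewrite mul1r.
have -> : ch x 0 (s i) - ch y 0 (s i) = ch (x - y) 0 (s i).
  by rewrite coordD -[- y]scaleN1r coordZ scaleN1r !mxE.
exact: coord_le.
Qed.

End CocycleMeasurability.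

Section DeterminantGrowth.
Context d (T : measurableType d) (R : realType) (P : probability T R).
Hypothesis P_complete : measure_is_complete P.
Variables (theta : R -> T -> T) (theta_flow : ergodic_flow P theta).
Variables (H : completeNormedModType R) (U : R -> T -> H -> H).
Hypotheses (U_rds : linear_rds theta U)
  (U_int_plus : log_integrable P theta (rds_plus U))
  (U_int_minus : log_integrable P theta (rds_minus U)).
Variables (n : nat) (ch : chart H n).

Let preserving t : measure_preserving P (theta t).
Proof. by split; [exact: (flow_measurable theta_flow)|exact: (flow_preserving theta_flow)]. Qed.

Let lndetD' := lndetD (rds0 U_rds) (rdsD U_rds) (rds_linear U_rds) ch.
Let lndet0' := lndet0 (flow0 theta_flow) (rds0 U_rds) (rdsD U_rds) (rds_linear U_rds) ch.

Let lndet_le_log_growth s w : `|s| <= 1 -> log_growth theta U w \is a fin_num ->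
  lndet U ch s w <= ln n`!%:R + n%:R * fine (log_growth theta U w).
Proof.
move=> s1 fw; apply: (lndet_le (rds0 U_rds) (rdsD U_rds) (rds_linear U_rds)) => x.
exact: (unit_time_bound U_rds).
Qed.

Lemma lndet_integrable s : `|s| <= 1 -> P.-integrable setT (EFin \o lndet U ch s).
Proof.
move=> s1; pose L := log_growth theta U.
have L_int := log_growth_integrable U_int_plus U_int_minus.
(* The value at [theta s w] bounds the inverse and so gives the lower bound. With n + 1 instead of n
   the factor is positive even for n = 0, so an infinite [L] makes [g] infinite. *)
pose g w := ((ln n`!%:R)%:E + n.+1%:R%:E * (L w + L (theta s w)))%E.
have g_int : P.-integrable setT g.
  apply: integrableD => //; first exact: finite_measure_integrable_cst.
  apply: integrableZl => //; apply: integrableD => //.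
  exact: (integrable_preserving (preserving s)).
apply: (le_integrable measurableT _ _ g_int).
  by apply/measurable_EFinP; exact: (measurable_lndet U_rds).
move=> w _; have L0 := log_growth_ge0 theta U.
have n0 : (0 : R) < n.+1%:R by rewrite ltr0n.
have ln0 : 0 <= ln n`!%:R :> R by rewrite ln_ge0// ler1n fact_gt0.
rewrite [leRHS]gee0_abs; last by rewrite adde_ge0 ?lee_fin// mule_ge0// adde_ge0.
have Lneq v : L v != -oo%E by rewrite -ltNye (lt_le_trans _ (L0 v)).
rewrite /g /=; have [fw|] := boolP (L w \is a fin_num); last first.
  rewrite ge0_fin_numE// -leNgt leye_eq => /eqP ->.
  by rewrite addye ?Lneq// gt0_muley ?lte_fin// addey// leey.
have [fsw|] := boolP (L (theta s w) \is a fin_num); last first.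
  rewrite ge0_fin_numE// -leNgt leye_eq => /eqP ->.
  by rewrite addey ?Lneq// gt0_muley ?lte_fin// addey// leey.
rewrite -(fineK fw) -(fineK fsw) -EFinD lee_fin.
have lw : 0 <= fine (L w) by rewrite fine_ge0.
have lsw : 0 <= fine (L (theta s w)) by rewrite fine_ge0.
have up := lndet_le_log_growth s1 fw.
have dn : lndet U ch (- s) (theta s w) <= ln n`!%:R + n%:R * fine (L (theta s w)).
  by apply: lndet_le_log_growth; rewrite ?normrN.
have : lndet U ch s w + lndet U ch (- s) (theta s w) = 0 by rewrite -lndetD' subrr lndet0'.
have nn : (0 : R) <= n%:R by [].
by rewrite ler_norml -natr1 -/L in up dn *; nra.
Qed.

Definition mean_lndet s := fine (\int[P]_w (lndet U ch s w)%:E).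

(** Running backwards negates the logarithm and moves the base point, and the latter preserves the
    measure. Hence the rates at +oo and -oo agree. *)
Lemma mean_lndetN s : `|s| <= 1 -> mean_lndet (- s) = - mean_lndet s.
Proof.
move=> s1; rewrite /mean_lndet.
have si := lndet_integrable s1.
have -> : (\int[P]_w (lndet U ch (- s) w)%:E =
    \int[P]_w ((-%E \o (EFin \o lndet U ch s)) \o theta (- s)) w)%E.
  apply: eq_integral => w _ /=; have := lndetD' (- s) s w; rewrite addNr lndet0'.
  by move=> /esym/eqP; rewrite addr_eq0 => /eqP ->.
rewrite (integral_preserving (preserving (- s)) (integrableN si)).
rewrite integralN ?fineN//=; exact: integrable_add_def.
Qed.

Lemma ae_tempered_full : measurable [set w | tempered_growth theta U w] /\
  P [set w | tempered_growth theta U w] = 1%E.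
Proof.
apply: (ae_complete_full P_complete).
exact: (ae_tempered_growth theta_flow U_rds U_int_plus U_int_minus).
Qed.

(** Splitting the time r + s k in both orders, the difference becomes that of the fixed-time
    quantity [lndet r] at two points of the orbit, which is tempered. *)
Lemma lndet_flow_diff w r s e : `|s| <= 1 -> tempered_growth theta U w -> 0 < e ->
  exists C, forall k : nat,
  `|lndet U ch (s * k%:R) (theta r w) - lndet U ch (s * k%:R) w| <= C + e * k%:R.
Proof.
move=> s1 gw e0.
have [C CP] := lndet_orbit_tempered (flow0 theta_flow) (flowD theta_flow) (rds0 U_rds)
  (rdsD U_rds) (rds_linear U_rds) ch r gw e0.
exists (C + `|lndet U ch r w|) => k.
have -> : lndet U ch (s * k%:R) (theta r w) - lndet U ch (s * k%:R) w =
    lndet U ch r (theta (s * k%:R) w) - lndet U ch r w.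
  have := lndetD' r (s * k%:R) w; rewrite addrC lndetD'.
  by lra.
apply: le_trans (ler_normB _ _) _; rewrite addrAC lerD2r.
apply: le_trans (CP _) _; rewrite lerD2l ler_wpM2l ?(ltW e0)//.
by rewrite normrM normr_nat ler_piMl.
Qed.

Lemma ae_lndet_mean s : `|s| <= 1 ->
  {ae P, forall w e, 0 < e -> exists C, forall k : nat,
    `|lndet U ch (s * k%:R) w - mean_lndet s * k%:R| <= C + e * k%:R}.
Proof.
move=> s1; have [mA PA] := ae_tempered_full.
have A_inv r w : tempered_growth theta U w -> tempered_growth theta U (theta r w).
  exact: (tempered_growth_flow (flowD theta_flow)).
have step k w : lndet U ch (s * k.+1%:R) w =
    lndet U ch (s * 1%:R) w + lndet U ch (s * k%:R) (theta s w).
  by rewrite mulr1 -lndetD' -natr1 mulrDr mulr1 addrC.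
have zero w : lndet U ch (s * 0%:R) w = 0 by rewrite mulr0 lndet0'.
have meas k : measurable_fun setT (lndet U ch (s * k%:R)) := measurable_lndet U_rds ch _.
have int1 : P.-integrable setT (EFin \o lndet U ch (s * 1%:R)).
  by rewrite mulr1; exact: lndet_integrable.
have up := ergodic_upper_bound theta_flow mA PA A_inv
  (f := fun k => lndet U ch (s * k%:R)) zero step meas int1
  (fun w r Aw e e0 => lndet_flow_diff r s1 Aw e0).
have step' k w : - lndet U ch (s * k.+1%:R) w =
    - lndet U ch (s * 1%:R) w + - lndet U ch (s * k%:R) (theta s w).
  by rewrite step opprD.
have zero' w : - lndet U ch (s * 0%:R) w = 0 by rewrite zero oppr0.
have meas' k : measurable_fun setT (fun w => - lndet U ch (s * k%:R) w).
  exact: measurableT_comp.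
have int1' : P.-integrable setT (EFin \o (fun w => - lndet U ch (s * 1%:R) w)).
  by have := integrableN int1; apply: eq_integrable.
have diff' w r : tempered_growth theta U w -> forall e, 0 < e -> exists C, forall k : nat,
    `|- lndet U ch (s * k%:R) (theta r w) - - lndet U ch (s * k%:R) w| <= C + e * k%:R.
  move=> gw e e0; have [C CP] := lndet_flow_diff r s1 gw e0.
  by exists C => k; rewrite -opprD normrN.
have dn := ergodic_upper_bound theta_flow mA PA A_inv zero' step' meas' int1' diff'.
have mE : fine (\int[P]_w (lndet U ch (s * 1%:R) w)%:E) = mean_lndet s by rewrite mulr1.
have mE' : fine (\int[P]_w (- lndet U ch (s * 1%:R) w)%:E) = - mean_lndet s.
  rewrite -mE -fineN -integralN ?integrable_add_def//.
apply: filterS2 up dn => w up dn e e0.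
have [C CP] := up e e0; have [D DP] := dn e e0.
rewrite mE in CP; rewrite mE' in DP; exists (`|C| + `|D|) => k.
rewrite ler_norml; have := CP k; have := DP k.
have := ler_norm C; have := ler_norm D; have := normr_ge0 C; have := normr_ge0 D.
by rewrite !mulrDl mulNr; lra.
Qed.

Definition lyapunov_sum := mean_lndet 1.

Lemma ae_lndet_sublinear :
  {ae P, forall w, sublinear (fun t => `|lndet U ch t w - lyapunov_sum * t|)}.
Proof.
have n1 : `|1 : R| <= 1 by rewrite normr1.
have nN1 : `|-1 : R| <= 1 by rewrite normrN1.
have [mA PA] := ae_tempered_full.
apply: filterS2 (full_ae mA PA) (filterI (ae_lndet_mean n1) (ae_lndet_mean nN1)).
move=> w gw [up dn].
apply: (lndet_sublinear (flow0 theta_flow) (flowD theta_flow) (rds0 U_rds)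
  (rdsD U_rds) (rds_linear U_rds) gw) => e e0.
have [C CP] := up e e0; have [D DP] := dn e e0.
exists (`|C| + `|D|) => -[k|k].
  have := CP k; rewrite mul1r -[Posz k]/(k%:Z) -pmulrn normr_nat => /le_trans; apply.
  by rewrite lerD2r (le_trans (ler_norm C))// lerDl.
have := DP k.+1; rewrite mean_lndetN// mulN1r mulNr -mulrN NegzE mulrNz -pmulrn.
rewrite normrN normr_nat => /le_trans; apply.
by rewrite lerD2r (le_trans (ler_norm D))// lerDr.
Qed.

End DeterminantGrowth.

(** * Oseledets frames *)

(* The conclusion of Oseledets' theorem in the form used here: the vectors
   [b j] have exponents [mu j], and their angles along the orbit are
   subexponential in both time directions. *)
Record oseledets_frame (R : realType) (T : Type) (H : normedModType R)
  (U : R -> T -> H -> H) (w : T) (n : nat) (b : 'I_n -> H) (mu : 'I_n -> R)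
  (eta : R -> R) : Prop := OseledetsFrame {
  frame_error : sublinear eta;
  frame_span : forall x, exists c, x = \sum_j c j *: b j;
  frame_lower : forall t c k,
    `|c k| * expR (mu k * t - eta t) <= `|U t w (\sum_j c j *: b j)|;
  frame_upper : forall t c, `|U t w (\sum_j c j *: b j)| <=
    \sum_j `|c j| * expR (mu j * t + eta t) }.

Lemma span_of_basis (R : realType) (H : normedModType R) n (ch : chart H n)
    (b : 'I_n -> H) : \det (coord_mx ch b) != 0 ->
  forall x, exists c, x = \sum_j c j *: b j.
Proof.
move=> detb x; have ub : coord_mx ch b \in unitmx by rewrite unitmxE unitfE.
exists (fun j => (ch x *m invmx (coord_mx ch b)) 0 j).
apply: (@coord_inj _ _ _ ch); rewrite coord_sum -[LHS](mulmxKV ub).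
apply/rowP => j; rewrite mxE summxE; apply: eq_bigr => i _.
by rewrite coordZ [in RHS]mxE [coord_mx _ _ _ _]mxE.
Qed.

Section FrameOfLyapunovSplitting.
Variables (R : realType) (T : Type) (theta : R -> T -> T).
Variables (H : normedModType R) (U : R -> T -> H -> H).
Hypotheses (flow0 : forall w, theta 0 w = w)
  (flowD : forall s t w, theta (s + t) w = theta s (theta t w))
  (U0 : forall w x, U 0 w x = x)
  (UD : forall t1 t2 w x, U (t1 + t2) w x = U t2 (theta t1 w) (U t1 w x))
  (U_linear : forall t w, linear (U t w)).
Variables (n : nat) (ch : chart H n) (w : T) (delta : R).
Hypotheses (w_tempered : tempered_growth theta U w)
  (w_det : sublinear (fun t => `|lndet U ch t w - delta * t|)).
Variables (I : set nat) (lam : nat -> R) (W : nat -> set H) (Winf : set H).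
Hypotheses (W_sum : direct_sum_seq I W Winf)
  (W_lyap : forall i x, I i -> W i x -> x != 0 ->
    (ln `|U t w x| / t @[t --> +oo] --> lam i) /\
    (ln `|U t w x| / t @[t --> -oo] --> lam i))
  (Winf_lyap : forall x, Winf x -> x != 0 ->
    (ln `|U t w x| / t @[t --> +oo] --> -oo) /\
    (ln `|U t w x| / t @[t --> -oo] --> -oo)).

Let in_block x := Winf x \/ exists i, I i /\ W i x.

(** Approximation by the [Winf] component and finitely many terms of the Oseledets series. *)
Let dense_span x e : 0 < e -> exists r : seq H,
  (forall y, y \in r -> in_block y) /\ `|x - \sum_(y <- r) y| < e.
Proof.
move=> e0; case: W_sum => _ [Winf0 _] /(_ x)[[y yinf] [[/= yW y0 yinfW cvgy] _]].
have /cvgrPdist_lt/(_ e e0)[N _ /(_ N (leqnn N)) HN] := cvgy.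
exists (yinf :: [seq y k | k <- iota 0 N]); split.
  move=> z; rewrite inE => /predU1P[->|/mapP[k _ ->]]; first by left.
  (* A term with index outside [I] is 0, which counts as an element of [Winf]. *)
  have [Ik|nIk] := pselect (I k); first by right; exists k; split => //; exact: yW.
  by left; rewrite y0.
move: HN; rewrite /= big_cons big_map opprD addrA; congr (`|_ - _| < e).
by rewrite /series /= /index_iota subn0.
Qed.

Lemma ln_det_basis_le (b : 'I_n -> H) : \det (coord_mx ch b) != 0 ->
  forall t, ln `|\det (coord_mx ch b)| + lndet U ch t w <=
    ln n`!%:R + \sum_j ln `|U t w (b j)|.
Proof.
move=> detb t; apply: (ln_det_frame_le (V := fun t => U t w)) => //.
- move=> s j; rewrite (cocycle_eq0 U0 UD U_linear).
  apply: contraNneq detb => bj0; rewrite (expand_det_row _ j) big1// => k _.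
  by rewrite mxE bj0 coord0 mxE mul0r.
- by move=> s; exact: (det_cocycle_neq0 U0 UD U_linear).
Qed.

(* A vector of [Winf] would make the determinant decay superexponentially. *)
Lemma block_basis_notin_Winf (b : 'I_n -> H) : (forall j, in_block (b j)) ->
  (forall j, b j != 0) -> \det (coord_mx ch b) != 0 -> forall j, ~ Winf (b j).
Proof.
move=> bW b0 detb j0 Wj0.
have ln_le j : exists M, \forall t \near +oo, ln `|U t w (b j)| / t <= M.
  case: (bW j) => [Wj|[i [Ii Wj]]].
    have [/cvgrNyPler/(_ 0 (num_real _)) h _] := Winf_lyap Wj (b0 j).
    by exists 0.
  have [h _] := W_lyap Ii Wj (b0 j).
  exists (lam i + 1); apply: (cvgr_le _ h); by rewrite ltrDl.
have [M MP] := choice ln_le.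
(* Of the 2 subtracted here, one unit absorbs the slope 1 of the error of the determinant; the other
   leaves t <= K, which is false for large [t]. *)
have [/cvgrNyPler/(_ (delta - 2 - \sum_(j | j != j0) M j) (num_real _)) h _] :=
  Winf_lyap Wj0 (b0 j0).
have [C CP] := w_det ltr01.
have hM : \forall t \near +oo, forall j, ln `|U t w (b j)| / t <= M j.
  exact: filter_forall.
pose K := ln n`!%:R - ln `|\det (coord_mx ch b)| + C.
near +oo_R => t.
have t0 : 0 < t by near: t; apply: nbhs_pinfty_gt; exact: num_real.
have Kt : K < t by near: t; apply: nbhs_pinfty_gt; exact: num_real.
have := ln_det_basis_le detb t; rewrite (bigD1 j0)//=.
have : ln `|U t w (b j0)| <= (delta - 2 - \sum_(j | j != j0) M j) * t.
  by rewrite -ler_pdivrMr//; near: t.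
have : \sum_(j | j != j0) ln `|U t w (b j)| <= (\sum_(j | j != j0) M j) * t.
  rewrite mulr_suml; apply: ler_sum => j _; rewrite -ler_pdivrMr//.
  have : forall j, ln `|U t w (b j)| / t <= M j by near: t.
  exact.
have := CP t; rewrite mul1r (gtr0_norm t0) ler_norml => /andP[+ _].
by move: Kt; rewrite /K; set S := \sum_(j | _) M j; lra.
Unshelve. all: by end_near. Qed.

Lemma frame_exists : exists (b : 'I_n -> H) mu eta,
  oseledets_frame U w b mu eta /\ forall j, exists i, I i /\ mu j = lam i.
Proof.
have [b [bW detb]] := basis_of_dense_span ch dense_span.
have b0 j : b j != 0.
  apply: contraNneq detb => bj0; rewrite (expand_det_row _ j) big1// => k _.
  by rewrite mxE bj0 coord0 mxE mul0r.
have nWinf := block_basis_notin_Winf bW b0 detb.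
have bi j : exists i, I i /\ W i (b j) by case: (bW j) => // /nWinf.
have [f fP] := choice bi.
pose mu j := lam (f j).
have Ub0 t j : U t w (b j) != 0 by rewrite (cocycle_eq0 U0 UD U_linear).
have detV t : \det (chart_mx ch (U t w)) != 0.
  exact: (det_cocycle_neq0 U0 UD U_linear).
have lyap j : sublinear (fun t => `|ln `|U t w (b j)| - mu j * t|).
  have [If Wf] := fP j; have [lp lm] := W_lyap If Wf (b0 j).
  exact: (lyapunov_sublinear flow0 flowD U0 UD U_linear).
exists b, mu, (regularity_error ch (fun t => U t w) b mu delta); split.
  split.
  - exact: regularity_error_sublinear.
  - exact: span_of_basis detb.
  - by move=> t c k; apply: regular_lower.
  - by move=> t c; apply: regular_upper.
by move=> j; exists (f j); split=> //; case: (fP j).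
Qed.

End FrameOfLyapunovSplitting.

(** * Spaces of prescribed growth *)

Section SlowSpace.
Variables (R : realType) (T : Type) (theta : R -> T -> T).
Variables (H : normedModType R) (U : R -> T -> H -> H).
Hypotheses (flow0 : forall w, theta 0 w = w)
  (flowD : forall s t w, theta (s + t) w = theta s (theta t w))
  (U0 : forall w x, U 0 w x = x)
  (UD : forall t1 t2 w x, U (t1 + t2) w x = U t2 (theta t1 w) (U t1 w x))
  (U_linear : forall t w, linear (U t w)).
Variables (ell : T -> R) (tau : nat -> R) (kappa : R -> R).

(** The exponential of [ell] is the largest growth of [U] within unit time of [tau k], so bounds at
    the sample times become bounds at all times in between. *)
Definition weighted_norm k w x :=
  expR (ell (theta (tau k) w) - kappa (tau k)) * `|U (tau k) w x|.

Definition slow_space w : set H :=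
  [set x | exists C, forall k, weighted_norm k w x <= C].

Lemma weighted_norm_ge0 k w x : 0 <= weighted_norm k w x.
Proof. by rewrite mulr_ge0// expR_ge0. Qed.

Lemma cocycleZ t w a x : U t w (a *: x) = a *: U t w x.
Proof.
have := U_linear t w a x 0; rewrite !addr0 => ->.
have := U_linear t w (-1) 0 0; rewrite scaler0 addr0 scaleN1r addNr => ->.
by rewrite addr0.
Qed.

Lemma weighted_normZ k w a x : weighted_norm k w (a *: x) = `|a| * weighted_norm k w x.
Proof. by rewrite /weighted_norm cocycleZ normrZ mulrCA. Qed.

Lemma weighted_norm_le_add k w a x y :
  weighted_norm k w (a *: x + y) <= `|a| * weighted_norm k w x + weighted_norm k w y.
Proof.
rewrite /weighted_norm U_linear mulrCA -mulrDr ler_wpM2l ?expR_ge0// -normrZ.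
exact: ler_normD.
Qed.

Lemma slow_space_subspace w : linear_subspace (slow_space w).
Proof.
split=> [|a x y [C CP] [D DP]].
  by exists 0 => k; have := weighted_normZ k w 0 0; rewrite scale0r normr0 mul0r => ->.
exists (`|a| * C + D) => k; apply: le_trans (weighted_norm_le_add _ _ _ _ _) _.
by rewrite lerD// ler_wpM2l.
Qed.

Lemma slow_spaceZ w a x : slow_space w x -> slow_space w (a *: x).
Proof.
have [h0 hP] := slow_space_subspace w.
by move=> /(hP a x 0) /(_ h0); rewrite addr0.
Qed.

Hypothesis ell_ge0 : forall w, 0 <= ell w.

Variables (w : T) (n : nat) (b : 'I_n -> H) (mu : 'I_n -> R) (eta : R -> R).
Hypotheses (w_frame : oseledets_frame U w b mu eta)
  (ell_sublinear : sublinear (fun s => ell (theta s w))).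
Variables (G : pred 'I_n) (e0 : R).
Hypotheses (e0_gt0 : 0 < e0)
  (slow_le : forall j, G j -> forall k, mu j * tau k + e0 * `|tau k| <= kappa (tau k))
  (fast_gt : forall j, ~~ G j -> forall C, exists k,
    kappa (tau k) + C < mu j * tau k - e0 * `|tau k|).

Let eta_s := frame_error w_frame.

Lemma slow_coord_eq0 s c : slow_space (theta s w) (U s w (\sum_j c j *: b j)) ->
  forall j, ~~ G j -> c j = 0.
Proof.
move=> [C CP] j Gj; apply/eqP; apply: contraT => cj0.
have [D DP] := eta_s e0_gt0.
have [k] := fast_gt Gj (ln (`|C| + 1) - ln `|c j| - mu j * s + D + e0 * `|s|).
rewrite ltNge => /negP; case.
have lcj : 0 < `|c j| by rewrite normr_gt0.
have lC : 0 < `|C| + 1 by rewrite ltr_wpDl.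
suff : ln `|c j| + (mu j * (s + tau k) - eta (s + tau k)) - kappa (tau k) <= ln (`|C| + 1).
  have := DP (s + tau k); rewrite mulrDr.
  have : e0 * `|s + tau k| <= e0 * `|s| + e0 * `|tau k|.
    by rewrite -mulrDr ler_wpM2l ?ler_normD// ltW.
  by lra.
rewrite -ler_expR lnK ?posrE// expRD expRD lnK ?posrE//.
apply: (@le_trans _ _ C); last by rewrite (le_trans (ler_norm C))// lerDl.
apply: le_trans (CP k); rewrite /weighted_norm -UD mulrC ler_pM ?expR_ge0//.
- by rewrite ler_expR lerDr.
- exact: (frame_lower w_frame).
Qed.

(** Pull [x] back to [w] and expand it there. The lower estimate at time [s] bounds the coordinates,
    the upper one at time s + tau k bounds the image, and the terms [mu j * s] cancel. *)
Lemma slow_bound_orbit e : 0 < e -> exists C, forall s x k,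
  slow_space (theta s w) x -> weighted_norm k (theta s w) x <= expR (C + e * `|s|) * `|x|.
Proof.
move=> egt0.
(* The error occurs three times in |s| ([eta] twice, [ell] once) and twice in |tau k|; the latter is
   paid by the gap [e0]. *)
pose d := Num.min (e / 3) (e0 / 2).
have d0 : 0 < d by rewrite lt_min !divr_gt0.
have [D DP] := eta_s d0; have [L LP] := ell_sublinear d0.
exists (n%:R + 2 * D + L) => s x k xslow.
have [c cE] := frame_span w_frame (U (- s) (theta s w) x).
have xE : x = U s w (\sum_j c j *: b j).
  by rewrite -cE (cocycleNK flow0 flowD U0 UD).
rewrite xE in xslow; have c0 := slow_coord_eq0 xslow.
rewrite /weighted_norm [in X in X <= _]xE -UD -flowD.
apply: (@le_trans _ _ (expR (ell (theta (tau k + s) w) - kappa (tau k)) *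
    (n%:R * (`|x| * expR (kappa (tau k) - e0 * `|tau k| + (2 * D + d * `|s| +
      d * (`|s| + `|tau k|))))))).
  rewrite ler_wpM2l ?expR_ge0//; apply: le_trans (frame_upper w_frame _ _) _.
  apply: (@le_trans _ _ (\sum_(j < n) `|x| * expR (kappa (tau k) - e0 * `|tau k| +
      (2 * D + d * `|s| + d * (`|s| + `|tau k|))))); last first.
    by rewrite sumr_const card_ord [leRHS]mulr_natl.
  apply: ler_sum => j _; have [Gj|nGj] := boolP (G j); last first.
    by rewrite c0// normr0 mul0r mulr_ge0// expR_ge0.
  have cx : `|c j| * expR (mu j * s - eta s) <= `|x|.
    by rewrite [in leRHS]xE; exact: (frame_lower w_frame).
  have -> : mu j * (s + tau k) + eta (s + tau k) =
      (mu j * s - eta s) + (mu j * tau k + eta s + eta (s + tau k)) by lra.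
  rewrite [in leLHS]expRD mulrA; apply: ler_pM; [|exact: expR_ge0|exact: cx|rewrite ler_expR].
    by rewrite mulr_ge0 ?expR_ge0.
  have := DP s; have := DP (s + tau k); have := slow_le Gj k.
  have : d * `|s + tau k| <= d * (`|s| + `|tau k|) by rewrite ler_wpM2l ?ler_normD// ltW.
  by lra.
have nexp : n%:R <= expR n%:R :> R by apply: le_trans (expR_ge1Dx _); rewrite lerDr.
set A := expR (_ - kappa _); set B := expR (_ + _).
have -> : A * (n%:R * (`|x| * B)) = n%:R * (A * B) * `|x| by ring.
rewrite ler_wpM2r//; apply: (@le_trans _ _ (expR n%:R * (A * B))).
  by rewrite ler_wpM2r// mulr_ge0// expR_ge0.
rewrite /A /B -!expRD ler_expR.
have := LP (tau k + s).
have : d * `|tau k + s| <= d * (`|s| + `|tau k|).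
  by rewrite ler_wpM2l ?(ltW d0)// addrC ler_normD.
have : d <= e / 3 by rewrite ge_min lexx.
have : d <= e0 / 2 by rewrite ge_min lexx orbT.
have := normr_ge0 s; have := normr_ge0 (tau k).
by nra.
Qed.

Lemma frame_slow_space j : G j -> slow_space w (b j).
Proof.
move=> Gj; have d0 : 0 < e0 / 2 by rewrite divr_gt0.
have [D DP] := eta_s d0; have [L LP] := ell_sublinear d0.
exists (expR (L + D)) => k.
have bE : b j = \sum_i (i == j)%:R *: b i.
  rewrite (bigD1 j)//= eqxx scale1r big1 ?addr0// => i /negbTE->.
  by rewrite scale0r.
rewrite /weighted_norm bE.
apply: (@le_trans _ _ (expR (ell (theta (tau k) w) - kappa (tau k)) *
    expR (mu j * tau k + eta (tau k)))).
  rewrite ler_wpM2l ?expR_ge0//; apply: le_trans (frame_upper w_frame _ _) _.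
  rewrite (bigD1 j)//= eqxx normr1 mul1r big1 ?addr0// => i /negbTE->.
  by rewrite normr0 mul0r.
rewrite -expRD ler_expR; have := LP (tau k); have := DP (tau k).
by have := slow_le Gj k; lra.
Qed.

End SlowSpace.

Lemma countable_enumeration (T : Type) (D : set T) (x0 : T) : countable D -> D x0 ->
  exists g : nat -> T, (forall n, D (g n)) /\ forall x, D x -> exists n, g n = x.
Proof.
move=> /countable_injP[f injf] Dx0.
have gP n : exists y, D y /\ forall x, D x -> f x = n -> y = x.
  have [[x [Dx fx]]|nx] := pselect (exists x, D x /\ f x = n).
    exists x; split=> // x' Dx' fx'; apply: injf; rewrite ?inE//.
    by rewrite fx fx'.
  by exists x0; split=> // x Dx fx; case: nx; exists x.
have [g gD] := choice gP; exists g; split=> [n|x Dx]; first by case: (gD n).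
by exists (f x); have [_] := gD (f x); apply.
Qed.

(** * Measurability of the optimal constant *)

Section GrowthConstantMeasurable.
Context d (T : measurableType d) (R : realType).
Variables (H : completeNormedModType R).
Hypotheses (ball_compact : precompact [set x : H | `|x| <= 1])
  (H_separable : separable_space H).
Variable q : nat -> T -> H -> R.
Hypotheses (mq : forall k x, measurable_fun setT (fun w => q k w x))
  (cq : forall k w, continuous (q k w)) (q_ge0 : forall k w x, 0 <= q k w x)
  (qZ : forall k w a x, q k w (a *: x) = `|a| * q k w x).

(** The least constant in q k w x <= K |x| on the slow space. It takes values in the extended reals
    because finiteness is only known on the good set. *)
Definition growth_constant w : \bar R := ereal_sup
  [set y | exists k x, [/\ exists C, forall i, q i w x <= C, `|x| <= 1 &
     y = (q k w x)%:E]].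

(** Naming an integer bound [M] and a margin 2^-p makes all constraints on [x] closed, and every
    quantifier except that over [x] countable. *)
Lemma growth_constant_gtP (c : R) w : (c%:E < growth_constant w)%E <->
  exists M k p x, [/\ `|x| <= 1, forall i, q i w x <= M%:R &
    c + 2^-1 ^+ p <= q k w x].
Proof.
split.
  move=> /ereal_sup_gt[_ [k [x [[C CP] x1 ->]]]]; rewrite lte_fin => cq1.
  have d0 : 0 < q k w x - c by rewrite subr_gt0.
  have [p pd] := half_exp_lt d0.
  exists (Num.bound `|C|), k, p, x; split=> // [i|].
    by apply: le_trans (CP i) _; rewrite (le_trans (ler_norm C))// ltW// archi_boundP.
  by move: pd; rewrite ltrBrDl => /ltW.
move=> [M [k [p [x [x1 qM qc]]]]].
apply: (@lt_le_trans _ _ (q k w x)%:E).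
  by rewrite lte_fin (lt_le_trans _ qc)// ltrDl exprn_gt0.
by apply: ereal_sup_ubound; exists k, x; split => //; exists M%:R.
Qed.

(** Strict inequalities with slack 2^-p, finitely many of them: they are open in [y], so a dense set
    detects them, and measurable in [w] for fixed [y]. *)
Let approx M k (c : R) p y w := [/\ `|y| < 1 + 2^-1 ^+ p,
  forall i, (i <= p)%N -> q i w y < M%:R + 2^-1 ^+ p & c - 2^-1 ^+ p < q k w y].

Let open_below (g : H -> R) v : continuous g -> open [set y | g y < v].
Proof.
by move=> /continuousP cg; apply: (cg [set r | r < v]); exact: open_lt.
Qed.

Let open_above (g : H -> R) v : continuous g -> open [set y | v < g y].
Proof.
by move=> /continuousP cg; apply: (cg [set r | r > v]); exact: open_gt.
Qed.

Let open_forall_lt w p (v : R) :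
  open [set y | forall i, (i <= p)%N -> q i w y < v].
Proof.
suff open_forall m : open [set y | forall i, (i < m)%N -> q i w y < v].
  exact: (open_forall p.+1).
elim: m => [|m IH].
  by rewrite [X in open X](_ : _ = setT); [exact: openT|apply/seteqP; split].
rewrite [X in open X](_ : _ = [set y | forall i, (i < m)%N -> q i w y < v] `&`
  [set y | q m w y < v]).
  by apply: openI => //; exact: open_below.
apply/seteqP; split => [y yq|y [yq ym] i].
  by split; [move=> i im; apply: yq; exact: ltnW|exact: yq].
by rewrite ltnS leq_eqVlt => /predU1P[->//|]; exact: yq.
Qed.

Let cluster_le (z : nat -> H) (x : H) (g : H -> R) (v a : R) N : continuous g ->
    cluster (z @ \oo) x -> 0 <= a ->
    (forall p, (N <= p)%N -> g (z p) <= v + a * 2^-1 ^+ p) -> g x <= v.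
Proof.
move=> cg zx a0 gz; rewrite leNgt; apply/negP => vx.
pose e := (g x - v) / 2.
have e0 : 0 < e / (a + 1) by rewrite !divr_gt0// ?subr_gt0// ltr_wpDl.
have [P HP] := half_exp_lt e0.
have zA : (z @ \oo) [set y | g y <= v + e].
  exists (maxn N P) => // p /=; rewrite geq_max => /andP[Np Pp].
  apply: le_trans (gz p Np) _; rewrite lerD2l.
  have hp : 2^-1 ^+ p <= e / (a + 1).
    by apply: le_trans (ltW HP); rewrite ler_wiXn2l// ?invr_ge0 ?invf_le1 ?ler1n.
  apply: (@le_trans _ _ ((a + 1) * (2^-1 ^+ p))).
    by rewrite ler_wpM2r ?exprn_ge0// lerDl.
  by rewrite mulrC -ler_pdivlMr// ltr_wpDl.
have xB : nbhs x [set y | v + e < g y].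
  apply: open_nbhs_nbhs; split; last by rewrite /= /e; lra.
  exact: open_above.
have [y [/= yA yB]] := zx _ _ zA xB.
by move: yB; rewrite ltNge yA.
Qed.

Let exists_in_ballP M k c w (D : set H) : dense D ->
  (exists x, [/\ `|x| <= 1, forall i, q i w x <= M%:R & c <= q k w x]) <->
  forall p, exists y, D y /\ approx M k c p y w.
Proof.
move=> denseD; have half0 p : 0 < 2^-1 ^+ p :> R by rewrite exprn_gt0.
split=> [[x [x1 qM qc]] p|hD].
  pose O := [set y | `|y| < 1 + 2^-1 ^+ p] `&`
    [set y | forall i, (i <= p)%N -> q i w y < M%:R + 2^-1 ^+ p] `&`
    [set y | c - 2^-1 ^+ p < q k w y].
  have openO : open O.
    apply: openI; first apply: openI.
    - by apply: (open_below (g := fun y : H => `|y|)) => y; exact: norm_continuous.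
    - exact: open_forall_lt.
    - exact: open_above.
  have [|y [Oy Dy]] := denseD O _ openO.
    exists x; split; first split => /=.
    - by rewrite (le_lt_trans x1)// ltrDl.
    - by move=> i _; rewrite (le_lt_trans (qM i))// ltrDl.
    - by rewrite /= (lt_le_trans _ qc)// ltrBlDr ltrDl.
  by exists y; split=> //; case: Oy => -[].
have [y yP] := choice hD.
have h10 p : 0 < 1 + 2^-1 ^+ p :> R by rewrite addr_gt0.
(* Rescaling brings the approximate solutions into the unit ball, where they have a cluster
   point. *)
pose z p := (1 + 2^-1 ^+ p)^-1 *: y p.
have zq i p : q i w (z p) = q i w (y p) / (1 + 2^-1 ^+ p).
  by rewrite qZ mulrC ger0_norm// invr_ge0 ltW.
have z1 p : `|z p| <= 1.
  have [_ [y1 _ _]] := yP p.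
  by rewrite normrZ normfV gtr0_norm// mulrC ler_pdivrMr// mul1r ltW.
have := ball_compact; rewrite precompactE => /(_ (z @ \oo) _)[].
  by exists 0%N => // p _; apply: subset_closure; exact: z1.
move=> x [_ zx]; exists x; split.
- apply: (cluster_le (g := fun y : H => `|y|) (a := 0) (N := 0) _ zx) => //.
    by move=> u; exact: norm_continuous.
  by move=> p _; rewrite mul0r addr0.
- move=> i; apply: (cluster_le (a := 1) (N := i) _ zx) => // p ip.
  rewrite zq mul1r; have [_ [_ /(_ i ip) yq _]] := yP p.
  apply: le_trans (ltW yq); rewrite ler_pdivrMr// ler_peMr ?q_ge0//.
  by rewrite lerDl ltW.
(* With h = 2^-p, rescaling costs at most (1 + |c|) h: (c - h) / (1 + h) >= c - (1 + |c|) h. *)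
- rewrite -lerN2; apply: (cluster_le (g := fun u => - q k w u) (a := 1 + `|c|) (N := 0) _ zx).
  + by move=> u; apply: continuousN; exact: cq.
  + by rewrite addr_ge0.
  move=> p _; rewrite zq; have [_ [_ _ yq]] := yP p.
  have : (c - 2^-1 ^+ p) / (1 + 2^-1 ^+ p) <= q k w (y p) / (1 + 2^-1 ^+ p).
    by rewrite ler_wpM2r ?invr_ge0 ?ltW.
  have : c - (1 + `|c|) * 2^-1 ^+ p <= (c - 2^-1 ^+ p) / (1 + 2^-1 ^+ p).
    rewrite ler_pdivlMr//; have := half0 p; move: (2^-1 ^+ p) => h h0.
    by have := ler_norm (- c); have := ler_norm c; rewrite normrN; nra.
  by lra.
Qed.

Lemma measurable_growth_constant : measurable_fun setT growth_constant.
Proof.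
have [D cD dD] := H_separable.
apply: (measurability _ (ErealGenOInfty.measurableE R)) => // _ [_ [c ->] <-].
rewrite setTI.
have [x0 [_ Dx0]] : setT `&` D !=set0 by apply: dD; [exists 0|exact: openT].
have [g [gD Dg]] := countable_enumeration cD Dx0.
have -> : growth_constant @^-1` `]c%:E, +oo[ = \bigcup_M \bigcup_k \bigcup_m
    \bigcap_p \bigcup_j [set w | approx M k (c + 2^-1 ^+ m) p (g j) w].
  apply/seteqP; split => w.
    rewrite /= in_itv/= andbT => /growth_constant_gtP[M [k [m [x xP]]]].
    exists M => //; exists k => //; exists m => // p _.
    have [/(_ (ex_intro _ x xP) p)[y [/Dg[j <-] yP]] _] :=
      exists_in_ballP M k (c + 2^-1 ^+ m) w dD.
    by exists j.
  move=> [M _ [k _ [m _ wP]]]; rewrite /= in_itv/= andbT; apply/growth_constant_gtP.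
  exists M, k, m; apply/(exists_in_ballP _ _ _ _ dD) => p.
  by have [j _ yP] := wP p I; exists (g j).
apply: bigcupT_measurable => M; apply: bigcupT_measurable => k.
apply: bigcupT_measurable => m; apply: bigcapT_measurable => p.
apply: bigcupT_measurable => j.
have mlt i v : measurable [set w | q i w (g j) < v].
  rewrite (_ : [set w | _] = (fun w => q i w (g j)) @^-1` `]-oo, v[).
    by rewrite -[_ @^-1` _]setTI; exact: mq.
  by apply/seteqP; split => w /=; rewrite in_itv.
have mgt i v : measurable [set w | v < q i w (g j)].
  rewrite (_ : [set w | _] = (fun w => q i w (g j)) @^-1` `]v, +oo[).
    by rewrite -[_ @^-1` _]setTI; exact: mq.
  by apply/seteqP; split => w /=; rewrite in_itv/= andbT.
rewrite (_ : [set w | _] = [set w | `|g j| < 1 + 2^-1 ^+ p] `&`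
  \bigcap_(i in [set i | (i <= p)%N]) [set w | q i w (g j) < M%:R + 2^-1 ^+ p] `&`
  [set w | c + 2^-1 ^+ m - 2^-1 ^+ p < q k w (g j)]); last first.
  by apply/seteqP; split => w => [[? ? ?]|[[? ?] ?]].
apply: measurableI => //; apply: measurableI.
  by case: (`|g j| < _); [rewrite (_ : [set _ | _] = setT)|rewrite (_ : [set _ | _] = set0)];
    rewrite ?set_true ?set_false.
exact: bigcap_measurableType.
Qed.

End GrowthConstantMeasurable.

(** * Temperedness and direct sums *)

Lemma sublinear_shift (R : realType) (f : R -> R) r :
  sublinear f -> sublinear (fun t => f (t + r)).
Proof.
move=> sf e e0; have [C CP] := sf e e0; exists (C + e * `|r|) => t.
apply: le_trans (CP _) _; rewrite -addrA lerD2l addrC -mulrDr.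
by rewrite ler_wpM2l ?ler_normD// ltW.
Qed.

(** The gap is stated as 2 e so that one [e] can absorb errors of the frame while the other beats
    constants. *)
Lemma finite_gap (R : realType) n (f : 'I_n -> R) : (forall j, f j != 0) ->
  exists e, 0 < e /\ forall j, 2 * e <= `|f j|.
Proof.
move=> f0; exists (2^-1 * \big[Order.min/1]_j `|f j|); split.
  rewrite mulr_gt0//; apply: (big_ind (fun x : R => 0 < x)) => // [x y x0 y0|j _].
    by rewrite lt_min x0.
  by rewrite normr_gt0.
move=> j; rewrite mulrA divff// mul1r.
by rewrite (bigD1 j)//= ge_min lexx.
Qed.

Section LogGrowth.
Variables (R : realType) (T : Type) (theta : R -> T -> T).
Variables (H : normedModType R) (U : R -> T -> H -> H).
Hypotheses (flow0 : forall w, theta 0 w = w)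
  (flowD : forall s t w, theta (s + t) w = theta s (theta t w))
  (U_linear : forall t w, linear (U t w)).

Lemma expR_le_logp (x : \bar R) l : 0 <= l -> (x <= (expR l)%:E)%E -> (logp x <= l%:E)%E.
Proof.
move=> l0; rewrite /logp ge_max lee_fin l0 andbT; case: x => [r| |] //.
  rewrite lee_fin; have [r0 _|r0 rl] := leP r 0; first by rewrite le0_lneNy ?leNye.
  by rewrite lne_EFin// lee_fin -ler_expR lnK ?posrE.
by rewrite le0_lneNy ?leNye.
Qed.

Lemma log_sup_opnorm_le (g : R -> H -> H) l : (forall t, linear (g t)) -> 0 <= l ->
    (forall t x, 0 <= t <= 1 -> `|g t x| <= expR l * `|x|) ->
  (logp (ereal_sup [set opnorm (g t) | t in `[0%R, 1%R]]) <= l%:E)%E.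
Proof.
move=> lg l0 gl; apply: expR_le_logp => //; apply: ge_ereal_sup => _ [t /= t01 <-].
rewrite in_itv/= in t01.
have [_] := opnorm_onP (E := setT) (lg t) (fun _ _ _ => I) (expR_ge0 l).
by apply => x _; exact: gl.
Qed.

(** The way back from pathwise growth to [log_growth]: the almost sure bounds hold at integer times
    only, while this one holds at every point of the orbit. *)
Lemma log_growth_sublinear w : tempered_growth theta U w -> forall e, 0 < e ->
  exists C, forall s, (log_growth theta U (theta s w) <= (C + e * `|s|)%:E)%E.
Proof.
move=> gw e e0; have e30 : 0 < e / 3 by rewrite divr_gt0.
have [C CP] := gw _ e30.
exists (3 * (`|C| + e / 3)) => s.
pose l := `|C| + e / 3 + e / 3 * `|s|.
have l0 : 0 <= l by rewrite !addr_ge0// ?mulr_ge0// ltW.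
have -> : 3 * (`|C| + e / 3) + e * `|s| = l + l + l by rewrite /l; field.
have Ul r t x : 0 <= r <= 1 -> `|t| <= 1 -> `|U t (theta r (theta s w)) x| <= expR l * `|x|.
  move=> r01 t1; rewrite -flowD; apply: le_trans (CP _ _ _ t1) _.
  rewrite ler_wpM2r// ler_expR /l -addrA lerD ?ler_norm//.
  suff : e / 3 * `|r + s| <= e / 3 * (1 + `|s|) by rewrite mulrDr mulr1.
  rewrite ler_wpM2l ?(ltW e30)//; apply: le_trans (ler_normD _ _) _.
  by rewrite lerD2r; case/andP: r01 => r0 r1; rewrite ger0_norm.
have bounds r : 0 <= r <= 1 -> `|r| <= 1 by move=> /andP[r0 r1]; rewrite ger0_norm.
have zero01 : 0 <= (0 : R) <= 1 by rewrite lexx ler01.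
rewrite !EFinD; apply: leeD; first apply: leeD; apply: log_sup_opnorm_le => // t x t01.
- by rewrite -[theta s w]flow0; apply: Ul => //; exact: bounds.
- apply: Ul => //; apply: bounds; move: t01 => /andP[t0 t1].
  by rewrite subr_ge0 t1 gerBl.
- by move=> y; rewrite /rds_minus U_linear.
- by rewrite /rds_minus -[theta s w]flow0; apply: Ul => //; rewrite normrN; exact: bounds.
Qed.

Lemma log_growth_fin w : tempered_growth theta U w ->
  forall s, log_growth theta U (theta s w) \is a fin_num.
Proof.
move=> gw s; have [C CP] := log_growth_sublinear gw ltr01.
rewrite ge0_fin_numE ?log_growth_ge0//; exact: le_lt_trans (CP s) (ltry _).
Qed.

Lemma fine_log_growth_sublinear w : tempered_growth theta U w ->
  sublinear (fun s => fine (log_growth theta U (theta s w))).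
Proof.
move=> gw e e0; have [C CP] := log_growth_sublinear gw e0; exists C => s.
by rewrite -lee_fin fineK ?log_growth_fin.
Qed.

End LogGrowth.

Lemma limf_esup_eq0 (R : realType) (F : set_system R) (f : R -> R) : ProperFilter F ->
    (forall t, 0 <= f t) -> (forall e, 0 < e -> F [set t | f t <= e]) ->
  limf_esup (fun t => (f t)%:E) F = 0%E.
Proof.
move=> FF f0 fe; apply/eqP; rewrite eq_le; apply/andP; split; last first.
  by apply: limf_esup_ge0 => [|t]; [exact: filter_not_empty|rewrite lee_fin].
apply/lee_addgt0Pr => e e0; rewrite add0e limf_esupE.
apply: (@le_trans _ _ (ereal_sup ((fun t => (f t)%:E) @` [set t | f t <= e]))).
  by apply: ereal_inf_lbound; exists [set t | f t <= e] => //; exact: fe.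
by apply: ge_ereal_sup => _ [t /= fte <-]; rewrite lee_fin.
Qed.

Section Tempered.
Context d (T : measurableType d) (R : realType) (P : probability T R).
Variable theta : R -> T -> T.

Lemma tempered_above_of_bound (A : set T) (X : T -> R) : invariant_full P theta A ->
    (forall w, 0 < X w) ->
    (forall w, A w -> forall e, 0 < e -> exists C, forall s,
      X (theta s w) <= expR (C + e * `|s|)) ->
  tempered_above P theta X.
Proof.
move=> invA X0 XP; exists A => // w Aw /=.
have small e : 0 < e -> exists M, forall t, M < `|t| ->
    Num.max (ln (X (theta t w))) 0 / `|t| <= e.
  move=> e0; have e20 : 0 < e / 2 by rewrite divr_gt0.
  have [C CP] := XP w Aw _ e20; exists (2 * `|C| / e) => t Mt.
  have t0 : 0 < `|t|.
    by apply: le_lt_trans Mt; rewrite divr_ge0 ?mulr_ge0// ltW.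
  rewrite ler_pdivrMr// ge_max; apply/andP; split; last by rewrite mulr_ge0// ltW.
  apply: (@le_trans _ _ (C + e / 2 * `|t|)).
    by rewrite -ler_expR lnK ?posrE.
  move: Mt; rewrite ltr_pdivrMr// => Mt; have := ler_norm C; lra.
split; apply: limf_esup_eq0 => [t|e e0]; rewrite ?divr_ge0// ?le_max ?lexx ?orbT//.
  have [M MP] := small e e0; exists `|M|; split => // t Mt /=; apply: MP.
  by apply: (le_lt_trans (ler_norm M)); apply: (lt_le_trans Mt); exact: ler_norm.
have [M MP] := small e e0; exists (- `|M|); split => // t Mt /=; apply: MP.
by have := ler_norm (- t); rewrite normrN; have := ler_norm M; lra.
Qed.

(** A variable that is at least 1 has an inverse of at most 1, so it is tempered from below. *)
Lemma tempered_of_bound (A : set T) (X : T -> R) : invariant_full P theta A ->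
    measurable_fun setT X -> (forall w, 1 <= X w) ->
    (forall w, A w -> forall e, 0 < e -> exists C, forall s,
      X (theta s w) <= expR (C + e * `|s|)) ->
  tempered P theta X.
Proof.
move=> invA mX X1 XP; have X0 w : 0 < X w := lt_le_trans ltr01 (X1 w).
split=> //; first exact: tempered_above_of_bound invA X0 XP.
apply: tempered_above_of_bound invA _ _ => [w|w Aw e e0]; first by rewrite invr_gt0.
exists 0 => s; rewrite add0r; apply: (@le_trans _ _ 1); first by rewrite invf_le1.
by rewrite -expR0 ler_expR mulr_ge0// ltW.
Qed.

End Tempered.

Section FrameDirectSum.
Variables (R : realType) (T : Type) (H : normedModType R) (U : R -> T -> H -> H).
Hypotheses (U0 : forall w x, U 0 w x = x).
Variables (w : T) (n : nat) (b : 'I_n -> H) (mu : 'I_n -> R) (eta : R -> R).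
Hypothesis w_frame : oseledets_frame U w b mu eta.

Lemma frame_free c : \sum_j c j *: b j = 0 -> forall j, c j = 0.
Proof.
move=> cb j; have := frame_lower w_frame 0 c j; rewrite cb U0 normr0.
rewrite mulr0 add0r pmulr_lle0 ?expR_gt0// normr_le0 => /eqP; exact.
Qed.

Lemma subspace_sum (E : set H) (Q : pred 'I_n) (c : 'I_n -> R) : linear_subspace E ->
  (forall j, Q j -> E (b j)) -> E (\sum_(j | Q j) c j *: b j).
Proof.
move=> [E0 EP] Eb; apply: (big_ind E) => // [x y Ex Ey|j Qj].
  by have := EP 1 x y Ex Ey; rewrite scale1r.
by have := EP (c j) (b j) 0 (Eb j Qj) E0; rewrite addr0.
Qed.

(** Together with [frame_span] this says that [E] is the span of the [b j] with [Q j], in the form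
    in which the slow spaces provide it. *)
Definition spanned_by (E : set H) (Q : pred 'I_n) := [/\ linear_subspace E,
  forall j, Q j -> E (b j) &
  forall c, E (\sum_j c j *: b j) -> forall j, ~~ Q j -> c j = 0].

Lemma direct_sum3_spanned (E F G : set H) (p q r : pred 'I_n) :
    spanned_by E p -> spanned_by F q -> spanned_by G r ->
    (forall j, [\/ [/\ p j, ~~ q j & ~~ r j], [/\ ~~ p j, q j & ~~ r j] |
      [/\ ~~ p j, ~~ q j & r j]]) ->
  direct_sum3 E F G.
Proof.
move=> [lE Eb Ec] [lF Fb Fc] [lG Gb Gc] part; split=> // x.
have [c ->] := frame_span w_frame x.
pose part_sum (Q : pred 'I_n) := \sum_(j | Q j) c j *: b j.
exists (part_sum p, part_sum q, part_sum r); split => /=.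
  split; [exact: subspace_sum|exact: subspace_sum|exact: subspace_sum|].
  rewrite /part_sum [X in X + _ + _]big_mkcond [X in _ + X + _]big_mkcond.
  rewrite [X in _ + X]big_mkcond -!big_split; apply: eq_bigr => j _ /=.
  by case: (part j) => -[]; do 3 (case: (_ j)) => //; rewrite ?addr0 ?add0r.
move=> [[y1 y2] y3] /= [Ey Fy Gy].
have [c1 e1] := frame_span w_frame y1; have [c2 e2] := frame_span w_frame y2.
have [c3 e3] := frame_span w_frame y3.
rewrite e1 in Ey *; rewrite e2 in Fy *; rewrite e3 in Gy *.
have z1 := Ec _ Ey; have z2 := Fc _ Fy; have z3 := Gc _ Gy.
move=> xE; have cE j : c j = c1 j + c2 j + c3 j.
  apply/eqP; rewrite -subr_eq0; apply/eqP.
  apply: (frame_free (c := fun j => c j - (c1 j + c2 j + c3 j))).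
  under eq_bigr do rewrite scalerBl !scalerDl.
  by rewrite sumrB !big_split/= xE subrr.
have sumE (a : 'I_n -> R) (Q : pred 'I_n) : (forall j, ~~ Q j -> a j = 0) ->
    (forall j, Q j -> c j = a j) -> part_sum Q = \sum_j a j *: b j.
  move=> aQ ca; rewrite /part_sum big_mkcond; apply: eq_bigr => j _.
  by case: (boolP (Q j)) => [/ca->//|/aQ->]; rewrite scale0r.
congr (_, _, _); apply: sumE => // j Qj; rewrite cE.
- by case: (part j) => -[]; rewrite ?Qj// => _ nq nr; rewrite z2// z3// !addr0.
- by case: (part j) => -[]; rewrite ?Qj// => np _ nr; rewrite z1// z3// add0r addr0.
- by case: (part j) => -[]; rewrite ?Qj// => np nq _; rewrite z1// z2// !add0r.
Qed.

End FrameDirectSum.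

Lemma linear_bounded_in_chart (R : realType) (H : normedModType R) n (ch : chart H n)
  (f : H -> H) : linear f -> exists C, forall x, `|f x| <= C * `|x|.
Proof.
move=> lf; exists (\sum_i `|f (cbasis ch i)|) => x.
rewrite {1}(coordK ch x) linear_sumZ//; apply: le_trans (ler_norm_sum _ _ _) _.
rewrite mulr_suml; apply: ler_sum => i _.
by rewrite normrZ mulrC ler_wpM2l// coord_le.
Qed.

Lemma nat_mul_gt (R : realType) (C e : R) : 0 < e -> exists k : nat, C < e * k%:R.
Proof.
move=> e0; exists (Num.bound (`|C| / e)); apply: (le_lt_trans (ler_norm C)).
by rewrite mulrC -ltr_pdivrMr// archi_boundP// divr_ge0// ltW.
Qed.

Lemma invariant_full_of_ae d (T : measurableType d) (R : realType)
    (P : probability T R) (theta : R -> T -> T) (A : set T) :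
    measure_is_complete P -> ergodic_flow P theta -> {ae P, forall w, A w} ->
    (forall t w, A w -> A (theta t w)) -> invariant_full P theta A.
Proof.
move=> P_complete flow /(ae_complete_full P_complete)[mA PA] Ainv; split=> // t.
apply/seteqP; split => w; last exact: Ainv.
by move=> /(Ainv (- t)); rewrite -(flowD flow) addNr (flow0 flow).
Qed.

(** * Tempered constants for the spaces of prescribed growth *)

Section GrowthConstant.
Context d (T : measurableType d) (R : realType) (P : probability T R).
Variables (theta : R -> T -> T) (theta_flow : ergodic_flow P theta).
Variables (H : completeNormedModType R) (U : R -> T -> H -> H).
Hypotheses (U_rds : linear_rds theta U)
  (U_int_plus : log_integrable P theta (rds_plus U))
  (U_int_minus : log_integrable P theta (rds_minus U)).
Hypotheses (ball_compact : precompact [set x : H | `|x| <= 1])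
  (H_separable : separable_space H).
Variables (n : nat) (ch : chart H n) (Omega : set T) (spectrum : set R).
Hypotheses (Omega_full : invariant_full P theta Omega)
  (Omega_tempered : forall w, Omega w -> tempered_growth theta U w)
  (Omega_frame : forall w, Omega w -> exists (b : 'I_n -> H) mu eta,
    oseledets_frame U w b mu eta /\ forall j, spectrum (mu j)).

Let ell w := fine (log_growth theta U w).

Let ell_ge0 w : 0 <= ell w.
Proof. by rewrite fine_ge0// log_growth_ge0. Qed.

Variables (tau : nat -> R) (kappa : R -> R).

(** Quantified over all families of exponents from the spectrum, because the frame and the indexing
    of its exponents vary with [w]. *)
Definition rate_separates (G : pred R) := forall (mu : 'I_n -> R),
  (forall j, spectrum (mu j)) -> exists e0, [/\ 0 < e0,
    forall j, G (mu j) -> forall k, mu j * tau k + e0 * `|tau k| <= kappa (tau k) &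
    forall j, ~~ G (mu j) -> forall C, exists k,
      kappa (tau k) + C < mu j * tau k - e0 * `|tau k|].

Variable G : pred R.
Hypothesis separated : rate_separates G.

Local Notation wnorm := (weighted_norm theta U ell tau kappa).

Definition subspace_of_rate := slow_space theta U ell tau kappa.

Let linU := rds_linear U_rds.

Let measurable_wnorm k x : measurable_fun setT (fun w => wnorm k w x).
Proof.
apply: measurable_funM; last exact: (measurable_norm_cocycle U_rds).
apply: measurableT_comp => //; apply: measurable_funB => //.
apply: measurableT_comp; last exact: (flow_measurable theta_flow).
have := measurable_int _ (fine_log_growth_integrable U_int_plus U_int_minus).
by move=> /measurable_EFinP.
Qed.

Let continuous_wnorm k w : continuous (wnorm k w).
Proof.
have [C CP] := linear_bounded_in_chart ch (linU (tau k) w).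
apply: (lipschitz_bound_continuous (C := expR (ell (theta (tau k) w) - kappa (tau k)) * C)).
move=> x y; rewrite /weighted_norm -mulrBr normrM ger0_norm ?expR_ge0// -mulrA.
rewrite ler_wpM2l ?expR_ge0//; apply: le_trans (CP (x - y)).
apply: le_trans (ler_dist_dist _ _) _.
have -> : U (tau k) w (x - y) = U (tau k) w x - U (tau k) w y.
  by rewrite -[x - y]addrC -scaleN1r linU scaleN1r addrC.
by [].
Qed.

Let GC := growth_constant wnorm.

Let GC_ge0 w : (0 <= GC w)%E.
Proof.
have wn0 k : wnorm k w 0 = 0.
  by have := weighted_normZ theta linU ell tau kappa k w 0 0; rewrite scale0r normr0 mul0r.
apply: ereal_sup_ubound; exists 0%N, 0; split; rewrite ?normr0 ?wn0//.
by exists 0 => i; rewrite wn0.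
Qed.

Let GC_orbit w : Omega w -> forall e, 0 < e -> exists C, forall s,
  (GC (theta s w) <= (expR (C + e * `|s|))%:E)%E.
Proof.
move=> Ow e e0; have gw := Omega_tempered Ow.
have [b [mu [eta [fr sp]]]] := Omega_frame Ow.
have [e1 [e10 slow fast]] := separated sp.
have ells := fine_log_growth_sublinear (flow0 theta_flow) (flowD theta_flow) linU gw.
have [C CP] := slow_bound_orbit (flow0 theta_flow) (flowD theta_flow) (rds0 U_rds)
  (rdsD U_rds) ell_ge0 fr ells (G := fun j => G (mu j)) e10 slow fast e0.
exists C => s; apply: ge_ereal_sup => _ [k [x [xE x1 ->]]]; rewrite lee_fin.
apply: le_trans (CP s x k xE) _.
by rewrite ler_piMr// expR_ge0.
Qed.

Let GC_fin w : Omega w -> GC w \is a fin_num.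
Proof.
move=> Ow; have [C /(_ 0)] := GC_orbit Ow ltr01; rewrite (flow0 theta_flow) => GCw.
by rewrite ge0_fin_numE// (le_lt_trans GCw)// ltry.
Qed.

Let wnorm_le w x k : Omega w -> subspace_of_rate w x -> wnorm k w x <= fine (GC w) * `|x|.
Proof.
move=> Ow xE; have wZ := weighted_normZ theta linU ell tau kappa.
have [->|x0] := eqVneq x 0.
  by have := wZ k w 0 0; rewrite scale0r !normr0 mul0r mulr0 => ->.
have nx0 : 0 < `|x| by rewrite normr_gt0.
rewrite -ler_pdivrMr// mulrC -[X in X * _]gtr0_norm ?invr_gt0// -wZ -lee_fin fineK ?GC_fin//.
apply: ereal_sup_ubound; exists k, (`|x|^-1 *: x); split => //.
  exact: (slow_spaceZ linU).
by rewrite normrZ normfV normr_id mulVf ?gt_eqF.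
Qed.

(** The factor exp c pays for replacing [t] by a sample time in the rate, and the summand 1 keeps
    [K] at least 1. Off the good set [fine] turns an infinite constant into 0, so [K] is finite
    everywhere. *)
Lemma tempered_growth_constant (region : set R) (rate : R -> R) c : 0 <= c ->
    (forall t, region t -> exists k, `|t - tau k| <= 1 /\ kappa (tau k) <= rate t + c) ->
  exists K, tempered P theta K /\ forall w, Omega w -> forall t, region t ->
    (opnorm_on (subspace_of_rate w) (U t w) <= (K w * expR (rate t))%:E)%E.
Proof.
move=> c0 cover; pose K w := expR c * (1 + fine (GC w)); exists K.
have K1 w : 1 <= K w.
  have := fine_ge0 (GC_ge0 w); have := expR_ge1Dx c; rewrite /K; nra.
split.
  apply: (tempered_of_bound Omega_full) => //.
    apply: measurable_funM => //; apply: measurable_funD => //.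
    apply: measurableT_comp => //.
    apply: measurable_growth_constant => // [k w x|k w a x].
      exact: weighted_norm_ge0.
    exact: (weighted_normZ theta linU).
  move=> w Ow e e0; have [C CP] := GC_orbit Ow e0.
  exists (c + 1 + `|C|) => s; rewrite /K -!addrA expRD ler_wpM2l ?expR_ge0// expRD.
  have a0 : 0 <= `|C| + e * `|s| by rewrite addr_ge0// mulr_ge0// ltW.
  have GCs : fine (GC (theta s w)) <= expR (`|C| + e * `|s|).
    have fs : GC (theta s w) \is a fin_num.
      by rewrite ge0_fin_numE// (le_lt_trans (CP s))// ltry.
    rewrite -lee_fin fineK//; apply: le_trans (CP s) _.
    by rewrite lee_fin ler_expR lerD2r ler_norm.
  have := expR_ge1Dx (1 : R); have := expR_ge1Dx (`|C| + e * `|s|).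
  by nra.
move=> w Ow t rt; have [k [tk kt]] := cover t rt.
have [_] := opnorm_onP (E := subspace_of_rate w) (linU t w)
  (fun a x => @slow_spaceZ _ _ _ _ _ linU ell tau kappa w a x)
  (mulr_ge0 (le_trans ler01 (K1 w)) (expR_ge0 (rate t))).
apply => x xE.
have -> : U t w x = U (t - tau k) (theta (tau k) w) (U (tau k) w x).
  by rewrite -(rdsD U_rds) addrC subrK.
have fw : log_growth theta U (theta (tau k) w) \is a fin_num.
  exact: (log_growth_fin (flow0 theta_flow) (flowD theta_flow) linU (Omega_tempered Ow)).
apply: le_trans (unit_time_bound U_rds (U (tau k) w x) tk fw) _.
have wx := wnorm_le k Ow xE.
(* The factor from the unit-time bound is exactly the weight built into [wnorm]. *)
apply: (@le_trans _ _ (expR (kappa (tau k)) * wnorm k w x)).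
  by rewrite /weighted_norm mulrA -expRD addrC subrK.
apply: (@le_trans _ _ (expR (rate t + c) * ((1 + fine (GC w)) * `|x|))).
  rewrite ler_pM ?expR_ge0 ?weighted_norm_ge0 ?ler_expR//; apply: le_trans wx _.
  by rewrite ler_wpM2r// lerDr.
by rewrite [leLHS](_ : _ = K w * expR (rate t) * `|x|)// /K expRD; ring.
Qed.

End GrowthConstant.

(** * Rates that separate the spectrum *)

Section RateGroups.
Variables (R : realType) (n : nat) (spectrum : set R).

Lemma rate_separates_stable (a : R) : (forall l, spectrum l -> l != a) ->
  rate_separates n spectrum (fun k => k%:R) (fun t => a * t) (fun l => l < a).
Proof.
move=> neq mu sp; have [e0 [e00 gap]] : exists e, 0 < e /\ forall j, 2 * e <= `|mu j - a|.
  by apply: finite_gap => j; rewrite subr_eq0 neq.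
exists e0; split=> // j.
  move=> lta k; have := gap j; rewrite ltr0_norm ?subr_lt0// normr_nat => gj.
  rewrite -mulrDl ler_wpM2r//; lra.
rewrite -leNgt => gea C; have [k kC] := nat_mul_gt C e00; exists k.
have := gap j; rewrite ger0_norm ?subr_ge0// normr_nat => gj.
have : 2 * e0 * k%:R <= (mu j - a) * k%:R by rewrite ler_wpM2r.
by lra.
Qed.

Lemma rate_separates_unstable (a : R) : (forall l, spectrum l -> l != a) ->
  rate_separates n spectrum (fun k => - k%:R) (fun t => a * t) (fun l => a < l).
Proof.
move=> neq mu sp; have [e0 [e00 gap]] : exists e, 0 < e /\ forall j, 2 * e <= `|mu j - a|.
  by apply: finite_gap => j; rewrite subr_eq0 neq.
exists e0; split=> // j.
  move=> lta k; have := gap j; rewrite gtr0_norm ?subr_gt0// normrN normr_nat => gj.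
  have : 2 * e0 * k%:R <= (mu j - a) * k%:R by rewrite ler_wpM2r.
  have : 0 <= e0 * k%:R by rewrite mulr_ge0// ltW.
  by lra.
rewrite -leNgt => gea C; have [k kC] := nat_mul_gt C e00; exists k.
have := gap j; rewrite ler0_norm ?subr_le0// normrN normr_nat => gj.
have : 2 * e0 * k%:R <= - (mu j - a) * k%:R by rewrite ler_wpM2r.
by lra.
Qed.

(** An enumeration of the integers, since sample times are indexed by [nat]; codes of no integer
    give the time 0, which does no harm. *)
Definition int_time (k : nat) : R := (odflt (0 : int) (choice.unpickle k))%:~R.

Lemma int_time_surj (m : int) : exists k, int_time k = m%:~R.
Proof. by exists (choice.pickle m); rewrite /int_time choice.pickleK. Qed.

(** An exponent larger than [a] in absolute value betrays itself in the time direction of its own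
    sign, so both directions must be sampled. *)
Lemma rate_separates_center (a : R) : (forall l, spectrum l -> `|l| != a) ->
  rate_separates n spectrum int_time (fun t => a * `|t|) (fun l => `|l| < a).
Proof.
move=> neq mu sp.
have [e0 [e00 gap]] : exists e, 0 < e /\ forall j, 2 * e <= `| `|mu j| - a|.
  by apply: finite_gap => j; rewrite subr_eq0 neq.
exists e0; split=> // j.
  move=> lta k; have := gap j; rewrite ltr0_norm ?subr_lt0// => gj.
  have : mu j * int_time k <= `|mu j| * `|int_time k| by rewrite -normrM ler_norm.
  have : 2 * e0 * `|int_time k| <= - (`|mu j| - a) * `|int_time k| by rewrite ler_wpM2r.
  have : 0 <= e0 * `|int_time k| by rewrite mulr_ge0// ltW.
  by lra.
rewrite -leNgt => gea C; have [k kC] := nat_mul_gt C e00.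
have := gap j; rewrite ger0_norm ?subr_ge0// => gj.
have : 2 * e0 * k%:R <= (`|mu j| - a) * k%:R by rewrite ler_wpM2r.
have [mu0|mu0] := leP 0 (mu j).
  have [i iE] := int_time_surj k%:Z; exists i.
  have : mu j * k%:R = `|mu j| * k%:R by rewrite ger0_norm.
  by rewrite iE -pmulrn normr_nat; lra.
have [i iE] := int_time_surj (- k%:Z); exists i.
have : mu j * k%:R = - `|mu j| * k%:R by rewrite ltr0_norm ?opprK.
by rewrite iE mulrNz -pmulrn normrN normr_nat; lra.
Qed.

End RateGroups.

Theorem theorem4 (R : realType) (d : measure_display) (T : measurableType d)
  (P : probability T R) (P_complete : measure_is_complete P)
  (theta : R -> T -> T) (theta_flow : ergodic_flow P theta)
  (H : completeNormedModType R)
  (dot : {dot H for idfun}) (H_hilbert : induces_norm dot)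
  (H_separable : separable_space H)
  (U : R -> T -> H -> H) (U_rds : linear_rds theta U)
  (U_compact : forall t w, compact_operator (U t w))
  (U_int_plus : log_integrable P theta (rds_plus U))
  (U_int_minus : log_integrable P theta (rds_minus U))
  (I : set nat) (lam : nat -> R) (U_lyap : lyapunov_exponents P theta U I lam)
  (alpha beta gamma : R)
  (alpha_notin : ~ (lam @` I) alpha)
  (beta_notin : ~ (lam @` I) beta)
  (gamma_notin : ~ (lam @` I) gamma)
  (gaps : [/\ - alpha < - gamma, - gamma < gamma & gamma < beta])
  (arranged : forall l, (lam @` I) l ->
    [\/ l < - alpha, - gamma < l < gamma | beta < l]) :
  exists Omega1 : set T, invariant_full P theta Omega1 /\
  exists (Eu Ec Es : T -> set H) (Ks Kc Ku : T -> R),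
    [/\ tempered P theta Ks, tempered P theta Kc, tempered P theta Ku &
    forall w, Omega1 w ->
    [/\ direct_sum3 (Eu w) (Ec w) (Es w),
        forall t, 0 <= t ->
          (opnorm_on (Es w) (U t w) <= (Ks w * expR (- alpha * t))%:E)%E,
        forall t,
          (opnorm_on (Ec w) (U t w) <= (Kc w * expR (gamma * `|t|))%:E)%E &
        forall t, t <= 0 ->
          (opnorm_on (Eu w) (U t w) <= (Ku w * expR (beta * t))%:E)%E]].
Proof.
(* A point is needed to apply compactness to [U 0 w0], the identity. *)
have [w0 _] : [set: T] !=set0.
  apply/set0P/eqP => T0; have := probability_setT P.
  by rewrite T0 measure0 => /esym/eqP; rewrite onee_eq0.
have ball_compact : precompact [set x : H | `|x| <= 1].
  have [_] := U_compact 0 w0; congr precompact.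
  apply/seteqP; split=> [_ [x x1 <-]|x x1]; first by rewrite /= (rds0 U_rds).
  by exists x => //; rewrite (rds0 U_rds).
have [n [ch]] := chart_of_precompact_ball H_hilbert ball_compact.
have fl0 := flow0 theta_flow; have flD := flowD theta_flow.
have U0 := rds0 U_rds; have UD := rdsD U_rds; have linU := rds_linear U_rds.
have [_ _ [A [W [Winf [full0 lyap0]]]]] := U_lyap.
pose delta := lyapunov_sum P U ch.
pose Omega1 : set T := [set w | [/\ A w, tempered_growth theta U w &
  sublinear (fun t => `|lndet U ch t w - delta * t|)]].
have Omega1_full : invariant_full P theta Omega1.
  apply: (invariant_full_of_ae P_complete theta_flow).
    have [mO PO _] := full0.
    apply: filterS2 (full_ae mO PO) (filterI
      (ae_tempered_growth theta_flow U_rds U_int_plus U_int_minus)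
      (ae_lndet_sublinear P_complete theta_flow U_rds U_int_plus U_int_minus ch)).
    by move=> w Ow [gw dw]; split.
  move=> r w [Ow gw dw]; split.
  - by have [_ _ /(_ r) inv] := full0; rewrite -inv in Ow.
  - exact: tempered_growth_flow.
  (* By the cocycle identity the error at [theta r w] is the shifted error at [w] minus a
     constant. *)
  apply: (sublinear_le _ (sublinearD (sublinear_shift r dw)
    (sublinear_cst `|lndet U ch r w - delta * r|))) => t.
  have -> : lndet U ch t (theta r w) - delta * t =
      (lndet U ch (t + r) w - delta * (t + r)) - (lndet U ch r w - delta * r).
    by rewrite [t + r]addrC (lndetD U0 UD linU); ring.
  exact: ler_normB.
exists Omega1; split=> //.
pose spectrum := lam @` I.
have Omega1_tempered w : Omega1 w -> tempered_growth theta U w by case.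
have Omega1_frame w : Omega1 w -> exists (b : 'I_n -> H) mu eta,
    oseledets_frame U w b mu eta /\ forall j, spectrum (mu j).
  move=> [Ow gw dw]; have [Wsum _ _ Wlyap Winflyap] := lyap0 w Ow.
  have [b [mu [eta [fr sp]]]] := frame_exists fl0 flD U0 UD linU gw dw Wsum Wlyap Winflyap.
  exists b, mu, eta; split=> // j; have [i [Ii ->]] := sp j; by exists i.
have [ag gg gb] := gaps.
have sepS : rate_separates n spectrum (fun k => k%:R) (fun t => - alpha * t)
    (fun l => l < - alpha).
  by apply: rate_separates_stable => l /arranged[]; lra.
have sepU : rate_separates n spectrum (fun k => - k%:R) (fun t => beta * t)
    (fun l => beta < l).
  by apply: rate_separates_unstable => l /arranged[]; lra.
have sepC : rate_separates n spectrum (@int_time R) (fun t => gamma * `|t|)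
    (fun l => `|l| < gamma).
  apply: rate_separates_center => l /arranged l3; apply/eqP => lg.
  have := ler_norm l; have := ler_norm (- l); rewrite normrN lg => lN lP.
  by case: l3 => [|lc|]; [lra|rewrite -ltr_norml lg ltxx in lc|lra].
have floorP (t : R) : 0 <= t -> exists k : nat, k%:R <= t /\ t < k%:R + 1.
  move=> t0; exists `|Num.floor t|%N.
  rewrite -[_%:R]/((`|Num.floor t|%N%:Z)%:~R) gez0_abs ?floor_ge0//.
  by rewrite floor_le -intrD1 floorD1_gt.
have coverS t : 0 <= t -> exists k : nat, `|t - k%:R| <= 1 /\
    - alpha * k%:R <= - alpha * t + `|alpha|.
  move=> /floorP[k [kt tk]]; exists k.
  have tk1 : `|t - k%:R| <= 1 by rewrite ler_norml; lra.
  split=> //; have := ler_norm (alpha * (t - k%:R)).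
  by have : `|alpha * (t - k%:R)| <= `|alpha| by [rewrite normrM ler_piMr]; lra.
have coverU t : t <= 0 -> exists k : nat, `|t - - k%:R| <= 1 /\
    beta * - k%:R <= beta * t + `|beta|.
  rewrite -oppr_ge0 => /floorP[k [kt tk]]; exists k.
  have tk1 : `|t - - k%:R| <= 1 by rewrite ler_norml; lra.
  split=> //; have := ler_norm (- (beta * (t - - k%:R))); rewrite normrN.
  by have : `|beta * (t - - k%:R)| <= `|beta| by [rewrite normrM ler_piMr]; lra.
have coverC (t : R) : exists k, `|t - int_time R k| <= 1 /\
    gamma * `|int_time R k| <= gamma * `|t| + gamma.
  have [k kE] := int_time_surj R (Num.floor t); exists k; rewrite kE.
  have mt : (Num.floor t)%:~R <= t by exact: floor_le.
  have tm : t < (Num.floor t)%:~R + 1 by rewrite -intrD1 floorD1_gt.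
  have r1 : `|t - (Num.floor t)%:~R| <= 1 by rewrite ler_norml; lra.
  split=> //; have : `|(Num.floor t)%:~R : R| <= `|t| + 1.
    rewrite -[X in `|X|](subrK t) -opprB addrC.
    by apply: le_trans (ler_normB _ _) _; rewrite lerD2l.
  by nra.
have gamma0 : 0 <= gamma by lra.
have [Ks [temps Ksle]] := tempered_growth_constant theta_flow U_rds U_int_plus
  U_int_minus ball_compact H_separable ch Omega1_full Omega1_tempered Omega1_frame sepS
  (region := [set t | 0 <= t]) (rate := fun t => - alpha * t) (normr_ge0 alpha) coverS.
have [Kc [tempc Kcle]] := tempered_growth_constant theta_flow U_rds U_int_plus
  U_int_minus ball_compact H_separable ch Omega1_full Omega1_tempered Omega1_frame sepC
  (region := setT) (rate := fun t => gamma * `|t|) gamma0 (fun t _ => coverC t).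
have [Ku [tempu Kule]] := tempered_growth_constant theta_flow U_rds U_int_plus
  U_int_minus ball_compact H_separable ch Omega1_full Omega1_tempered Omega1_frame sepU
  (region := [set t | t <= 0]) (rate := fun t => beta * t) (normr_ge0 beta) coverU.
exists (subspace_of_rate theta U (fun k => - k%:R) (fun t => beta * t)),
  (subspace_of_rate theta U (@int_time R) (fun t => gamma * `|t|)),
  (subspace_of_rate theta U (fun k => k%:R) (fun t => - alpha * t)), Ks, Kc, Ku.
split=> // w Ow; split.
- have [b [mu [eta [fr sp]]]] := Omega1_frame w Ow.
  have ells := fine_log_growth_sublinear fl0 flD linU (Omega1_tempered w Ow).
  have ell_ge0 v : 0 <= fine (log_growth theta U v) by rewrite fine_ge0// log_growth_ge0.
  have spanned tau kappa G : rate_separates n spectrum tau kappa G ->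
      spanned_by b (subspace_of_rate theta U tau kappa w) (fun j => G (mu j)).
    move=> /(_ mu sp)[e0 [e00 slow fast]]; split.
    + exact: slow_space_subspace.
    + exact: (frame_slow_space fr ells e00 slow).
    + move=> c cE; apply: (slow_coord_eq0 UD ell_ge0 fr e00
        (G := fun j => G (mu j)) fast (s := 0)).
      by rewrite fl0 U0.
  apply: (direct_sum3_spanned U0 fr (spanned _ _ _ sepU) (spanned _ _ _ sepC)
    (spanned _ _ _ sepS)) => j.
  (* Each admissible range of an exponent passes exactly one of the three tests, because -alpha <
     -gamma and gamma < beta. *)
  have := arranged _ (sp j); rewrite -!leNgt -ltr_norml => -[l1|l2|l3].
  + apply: Or33; split => //; first by lra.
    by have := ler_norm (- mu j); rewrite normrN; lra.
  + by apply: Or32; move: l2; rewrite ltr_norml => /andP[? ?]; split; lra.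
  + apply: Or31; split => //; last by lra.
    by have := ler_norm (mu j); lra.
- by move=> t t0; exact: Ksle.
- by move=> t; exact: Kcle.
- by move=> t t0; exact: Kule.
Qed.
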